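(* Let $n\ge 3$ and $\Pi=\{0,1\}^n$. Let $W$ be an $n$-dimensional complex vector space with basis $\epsilon_1,\dots,\epsilon_n$, $W^\vee$ its dual, and $V=W\oplus W^\vee$ with the nondegenerate symmetric form $\langle (w_1,w_1^\vee),(w_2,w_2^\vee)\rangle=\tfrac12(w_1^\vee(w_2)+w_2^\vee(w_1))$. Let $S_+=\bigwedge^{\mathrm{even}}W$ and $S_-=\bigwedge^{\mathrm{odd}}W$ be the two half-spin representations of $\mathrm{Spin}(2n)=\mathrm{Spin}(V)$ (acting through the Clifford module structure on $\bigwedge^\bullet W$ in which $u\in W$ acts by $u\wedge\cdot$ and $u^\vee\in W^\vee$ acts by contraction). For $J\in\Pi$ let $v_J=\epsilon_{j_1}\wedge\cdots\wedge\epsilon_{j_r}$ where $j_1<\dots<j_r$ are the indices with $J_{j}=1$; use the bases $\{v_J\}_{J\in\Pi^{\mathrm{even}}}$ of $S_+$ and $\{v_J\}_{J\in\Pi^{\mathrm{odd}}}$ of $S_-$ to identify $\mathbb{P}(\mathbb{C}^{\Pi^{\mathrm{even}}})\times\mathbb{P}(\mathbb{C}^{\Pi^{\mathrm{odd}}})$ with $\mathbb{P}(S_+)\times\mathbb{P}(S_-)$. Let $\mathring{Y}'\subset(\mathbb{C}^\times)^\Pi$ be the solution set of $$x_I\,x_{I+e_j+e_k+e_\ell}+x_{I+e_j+e_\ell}\,x_{I+e_k}=x_{I+e_j+e_k}\,x_{I+e_\ell}+x_{I+e_k+e_\ell}\,x_{I+e_j}$$ for all $j<k<\ell$ and all admissible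 $I$, let $\mathring{X}'=\mathring{Y}'/(\mathbb{C}^\times)^2$ (where $(t,u)$ scales even coordinates by $t$ and odd coordinates by $u$), and let $X'$ be its closure in $\mathbb{P}(S_+)\times\mathbb{P}(S_-)$. Consider the embedding of $\mathrm{IG}(n-1,2n)$ (isotropic $(n-1)$-planes in $V$) given by the composite $\mathrm{IG}(n-1,2n)\hookrightarrow \mathrm{G}(n-1,2n)\hookrightarrow\mathbb{P}(\bigwedge^{n-1}V)\hookrightarrow\mathbb{P}(S_+\otimes S_-)$ (Plücker embedding followed by the $\mathrm{Spin}(2n)$-equivariant inclusion of the irreducible summand $\bigwedge^{n-1}V\subset S_+\otimes S_-$), whose image lies in the Segre image of $\mathbb{P}(S_+)\times\mathbb{P}(S_-)$. Then $X'$ equals the image of $\mathrm{IG}(n-1,2n)$ under this embedding.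
   Context: Even/odd elements of $\Pi$ are those with even/odd coordinate sum. $\bigwedge^{n-1}V$ occurs in $S_+\otimes S_-$ as the irreducible summand of highest weight $(2,\dots,2,0)$, so the equivariant inclusion is determined up to scalar; the isotropic subspace $\mathrm{span}(\epsilon_1,\dots,\epsilon_{n-1})$ maps to the product of the highest weight lines of $S_+$ and $S_-$. *)

(* Defs.v *)
From HB Require Import structures.
From mathcomp Require Import all_boot all_order all_algebra.
From mathcomp Require Import mpoly complex.
From mathcomp Require Import classical_sets reals.

Set Implicit Arguments.
Unset Strict Implicit.
Unset Printing Implicit Defensive.

Import GRing.Theory.

Local Open Scope ring_scope.

(* {0,1}^n is encoded as {set 'I_n}, J being the set of indices j with
   J_j = 1; thus I + e_j is j |: I when j \notin I. *)

(* The exterior algebra of F^d, in the coordinates of the basis (v_J)_J. *)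
Definition ext (F : fieldType) (d : nat) := {ffun {set 'I_d} -> F^o}.

Definition vb (F : fieldType) (d : nat) (J : {set 'I_d}) : ext F d :=
  [ffun K => (K == J)%:R].

Definition eb (F : fieldType) (d : nat) (j : 'I_d) : 'rV[F]_d := delta_mx 0 j.

Definition sgn (F : fieldType) (d : nat) (j : 'I_d) (K : {set 'I_d}) : F :=
  (-1) ^+ #|[pred k in K | (k < j)%N]|.

(* u /\ s; on the basis, e_j /\ v_J = (-1)^#{k in J | k < j} v_(J + e_j) if
   j \notin J, and 0 otherwise. *)
Definition wedge (F : fieldType) (d : nat) (u : 'rV[F]_d) (s : ext F d) :
    ext F d :=
  [ffun K : {set 'I_d} =>
     \sum_(j in K) sgn F j K * u 0 j * s (K :\ j)].

(* Contraction by the linear form with coordinates u in the dual basis; on the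
   basis, e_j^* contracts v_J to (-1)^#{k in J | k < j} v_(J - e_j) if j \in J,
   and to 0 otherwise. *)
Definition contract (F : fieldType) (d : nat) (u : 'rV[F]_d) (s : ext F d) :
    ext F d :=
  [ffun K : {set 'I_d} =>
     \sum_(j | j \notin K) sgn F j K * u 0 j * s (j |: K)].

Definition wedges (F : fieldType) (d : nat) (us : seq 'rV[F]_d) : ext F d :=
  foldr (@wedge F d) (vb F finset.set0) us.

Definition extpow (F : fieldType) (d k : nat) : {vspace ext F d} :=
  <<[seq vb F J | J : {set 'I_d} <- enum {set 'I_d} & #|J| == k]>>%VS.

(* The map induced on the exterior algebra by a linear map A. *)
Definition extmap (F : fieldType) (d : nat) (A : 'rV[F]_d -> 'rV[F]_d)
    (w : ext F d) : ext F d :=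
  \sum_(K : {set 'I_d}) (w K : F) *: wedges [seq A (eb F k) | k <- enum K].

(* V = W + W^*, W = F^n: the left block of a row holds the coordinates in the
   basis e_1, .., e_n of W, the right block those in the dual basis of W^*. *)
Definition V (F : fieldType) (n : nat) := 'rV[F]_(n + n).

Definition pairing (F : fieldType) (n : nat) (f w : 'rV[F]_n) : F :=
  \sum_(i < n) f 0 i * w 0 i.

Definition form (F : fieldType) (n : nat) (x y : V F n) : F :=
  2%:R^-1 * (pairing (rsubmx x) (lsubmx y) + pairing (rsubmx y) (lsubmx x)).

Definition rho (F : fieldType) (n : nat) (x : V F n) (s : ext F n) : ext F n :=
  wedge (lsubmx x) s + contract (rsubmx x) s.

(* Over an algebraically closed field, Spin(V) is the group of products of an
   even number of vectors x with <x, x> = 1 in the Clifford algebra; the latter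
   is represented faithfully on the exterior algebra of W by rho, hence
   elements of Spin(V) are identified with their actions. *)
Definition spin (F : fieldType) (n : nat) (g : ext F n -> ext F n) : Prop :=
  exists xs : seq (V F n),
    [/\ ~~ odd (size xs), {in xs, forall x, form x x = 1}
      & forall s, g s = foldr (@rho F n) s xs].

(* A is the action of g on V, i.e. A x = g x g^-1 in the Clifford algebra. *)
Definition spin_vector (F : fieldType) (n : nat) (g : ext F n -> ext F n)
    (A : V F n -> V F n) : Prop :=
  forall x s, rho (A x) (g s) = g (rho x s).

Definition halfspin (F : fieldType) (n : nat) (b : bool) : {vspace ext F n} :=
  <<[seq vb F J | J : {set 'I_n} <- enum {set 'I_n} & odd #|J| == b]>>%VS.

Definition Splus (F : fieldType) (n : nat) := halfspin F n false.
Definition Sminus (F : fieldType) (n : nat) := halfspin F n true.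

Definition ext2 (F : fieldType) (n : nat) :=
  {ffun {set 'I_n} * {set 'I_n} -> F^o}.

Definition tens (F : fieldType) (n : nat) (p q : ext F n) : ext2 F n :=
  [ffun JK => (p JK.1 : F) * q JK.2].

Definition tensv (F : fieldType) (n : nat) (P Q : {vspace ext F n}) :
    {vspace ext2 F n} :=
  <<[seq tens p q | p <- vbasis P, q <- vbasis Q]>>%VS.

Definition tensmap (F : fieldType) (n : nat) (g h : ext F n -> ext F n)
    (T : ext2 F n) : ext2 F n :=
  \sum_(J : {set 'I_n}) \sum_(K : {set 'I_n})
     (T (J, K) : F) *: tens (g (vb F J)) (h (vb F K)).

(* phi restricted to the (n-1)-st exterior power of V is a Spin(V)-equivariant
   injection into S_+ (x) S_-; its values elsewhere are irrelevant. *)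
Definition equivariant_inclusion (F : fieldType) (n : nat)
    (phi : 'Hom(ext F (n + n), ext2 F n)) : Prop :=
  let U := extpow F (n + n) n.-1 in
  [/\ (phi @: U <= tensv (Splus F n) (Sminus F n))%VS,
      {in U &, injective phi}
    & forall g A, spin g -> spin_vector g A ->
        {in U, forall w, phi (extmap A w) = tensmap g g (phi w)}].

(* The projective space of a vector space U, as the set of lines in U. *)
Definition proj (F : fieldType) (vT : vectType F) (U : {vspace vT}) :
    set {vspace vT} :=
  fun L => (L <= U)%VS /\ \dim L = 1%N.

Definition projS (F : fieldType) (n : nat) :
    set ({vspace ext F n} * {vspace ext F n}) :=
  fun PQ => proj (Splus F n) PQ.1 /\ proj (Sminus F n) PQ.2.

Definition segre (F : fieldType) (n : nat)
    (PQ : {vspace ext F n} * {vspace ext F n}) : {vspace ext2 F n} :=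
  tensv PQ.1 PQ.2.

(* Polynomials in the coordinates x_J; the variable number i is x_(enum_val i).
   Bidegrees are with respect to the even and the odd coordinates. *)
Definition coordpoly (F : fieldType) (n : nat) := {mpoly F[#|{set 'I_n}|]}.

Definition bihomog (F : fieldType) (n a b : nat) (f : coordpoly F n) : Prop :=
  forall m, m \in msupp f ->
    (\sum_(i | ~~ odd #|enum_val i : {set 'I_n}|) m i = a)%N /\
    (\sum_(i | odd #|enum_val i : {set 'I_n}|) m i = b)%N.

Definition vanishes (F : fieldType) (n : nat) (f : coordpoly F n)
    (PQ : {vspace ext F n} * {vspace ext F n}) : Prop :=
  forall p q, p \in PQ.1 -> q \in PQ.2 ->
    f.@[fun i => (p + q) (enum_val i)] = 0.

(* Zariski-closed subsets and closure in P(S_+) x P(S_-). *)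
Definition zclosed (F : fieldType) (n : nat)
    (Z : set ({vspace ext F n} * {vspace ext F n})) : Prop :=
  exists2 E : set (coordpoly F n),
    forall f, E f -> exists a b, bihomog a b f
    & forall PQ, Z PQ <-> projS PQ /\ forall f, E f -> vanishes f PQ.

Definition zclosure (F : fieldType) (n : nat)
    (A : set ({vspace ext F n} * {vspace ext F n})) :
    set ({vspace ext F n} * {vspace ext F n}) :=
  fun PQ => forall Z, zclosed Z -> (forall x, A x -> Z x) -> Z PQ.

Definition Y0 (F : fieldType) (n : nat) : set (ext F n) := fun x =>
  (forall J, x J != 0) /\
  forall (j k l : 'I_n) (I : {set 'I_n}), (j < k < l)%N ->
    j \notin I -> k \notin I -> l \notin I ->
    (x I : F) * x (j |: (k |: (l |: I))) + (x (j |: (l |: I)) : F) * x (k |: I)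
    = (x (j |: (k |: I)) : F) * x (l |: I)
      + (x (k |: (l |: I)) : F) * x (j |: I).

Definition parity_part (F : fieldType) (n : nat) (b : bool) (x : ext F n) :
    ext F n :=
  [ffun J : {set 'I_n} => if odd #|J| == b then x J else 0].

(* The quotient of Y0 by the two scalings, inside P(S_+) x P(S_-). *)
Definition X0 (F : fieldType) (n : nat) :
    set ({vspace ext F n} * {vspace ext F n}) := fun PQ =>
  exists2 x, Y0 x & PQ = (<[parity_part false x]>%VS, <[parity_part true x]>%VS).

Definition X (F : fieldType) (n : nat) := zclosure (@X0 F n).

Definition IG (F : fieldType) (n : nat) : set {vspace V F n} := fun L =>
  \dim L = n.-1 /\ {in L &, forall x y, form x y = 0}.

Definition plucker (F : fieldType) (d : nat) (L : {vspace 'rV[F]_d}) :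
    {vspace ext F d} :=
  <[wedges (vbasis L)]>%VS.

Definition IG_embedding (F : fieldType) (n : nat)
    (phi : 'Hom(ext F (n + n), ext2 F n)) (L : {vspace V F n}) :
    {vspace ext2 F n} :=
  (phi @: plucker L)%VS.

(* Main.v *)
Require Import Defs.
From HB Require Import structures.
From mathcomp Require Import classical_sets reals.
From mathcomp Require Import all_boot all_order all_algebra.
From mathcomp Require Import mpoly complex.
From mathcomp Require Import ring.

(** Let Omega = sum_a e_a (x) e_a^* act on S (x) S through the Clifford action,
    a ranging over the basis of V.  The pairs of lines (p, q) in S_+ and S_-
    with Omega (p (x) q) = q (x) p form a closed, Spin-invariant set.  If
    p_J <> 0, then contracting this equation with the coordinates of index
    J + e_k produces an isotropic subspace of dimension n - 1 that annihilates p
    and q; by Witt's theorem Spin moves it to span(e_i^* : i <> i0), so (p, q)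
    lies in the Spin-orbit of (1, e_i0).  Torus weights show that an equivariant
    inclusion maps the wedge of the e_i^*, i <> i0, to a multiple of 1 (x) e_i0,
    whence the orbit is the image of IG(n-1, 2n).

    The cube equations are coordinates of Omega (p (x) q) = q (x) p.  Conversely
    a solution x without zero coordinates is determined by its coordinates of
    degree at most 2, and exp(w) (1, u), for suitable w in the second exterior
    power of W and u in W, is a point of the orbit with the same ones.  Hence
    the open set lies in the orbit.  It is dense there: the all-ones vector is a
    solution, so on a line in V^2m joining the factors of an arbitrary group
    element to those of a group element producing the all-ones vector, almost
    every point gives a solution without zero coordinates. *)

Set Implicit Arguments.
Unset Strict Implicit.
Unset Printing Implicit Defensive.

Import Defs GRing.Theory Num.Theory.

Local Open Scope ring_scope.

(** * Toggling one element of a set, and the resulting signs *)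

Section Flip.

Variables (F : fieldType) (d : nat).
Implicit Types (i j k : 'I_d) (K : {set 'I_d}).

Definition flip j K : {set 'I_d} := if j \in K then K :\ j else j |: K.

Lemma in_flip i j K : (i \in flip j K) = (i \in K) (+) (i == j).
Proof.
rewrite /flip; case: ifP => jK; rewrite !inE; case: eqP => [->|_] //=;
  by rewrite ?jK ?addbF.
Qed.

Lemma flipK j : involutive (flip j).
Proof. by move=> K; apply/setP=> i; rewrite !in_flip -addbA addbb addbF. Qed.

Lemma flipC i j K : flip i (flip j K) = flip j (flip i K).
Proof. by apply/setP=> k; rewrite !in_flip -!addbA [X in _ (+) X]addbC. Qed.

Lemma flip_in j K : j \in K -> flip j K = K :\ j.
Proof. by rewrite /flip => ->. Qed.

Lemma flip_notin j K : j \notin K -> flip j K = j |: K.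
Proof. by rewrite /flip => /negPf->. Qed.

Lemma odd_flip j K : odd #|flip j K| = ~~ odd #|K|.
Proof.
rewrite /flip; case: ifP => jK.
  by rewrite (cardsD1 j K) jK /= negbK.
by rewrite cardsU1 jK.
Qed.

Lemma sgnE j K : sgn F j K = \prod_(k < d) (-1) ^+ ((k \in K) && (k < j)%N).
Proof.
rewrite /sgn -prodr_const big_mkcond /=; apply: eq_bigr => k _.
by rewrite unfold_in /=; case: (_ && _).
Qed.

Lemma sgn_flip i j K : sgn F i (flip j K) = (-1) ^+ (j < i)%N * sgn F i K.
Proof.
rewrite !sgnE (bigD1 j) //= [in RHS](bigD1 j) //= mulrA; congr (_ * _); last first.
  by apply: eq_bigr => k /negPf kj; rewrite in_flip kj addbF.
rewrite in_flip eqxx addbT.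
by case: (j \in K); case: (j < i)%N; rewrite /= ?expr0 ?expr1 ?mulrNN ?mulr1.
Qed.

Lemma sgn_sqr j K : sgn F j K * sgn F j K = 1.
Proof. by rewrite /sgn -expr2 sqrr_sign. Qed.

Lemma sgn_neq0 j K : sgn F j K != 0.
Proof. by rewrite /sgn signr_eq0. Qed.

Lemma sgn_flip_id j K : sgn F j (flip j K) = sgn F j K.
Proof. by rewrite sgn_flip ltnn expr0 mul1r. Qed.

End Flip.

(* The pair (true, j) stands for e_j and (false, j) for e_j^*. *)
Definition dual (n : nat) (a : bool * 'I_n) : bool * 'I_n := (~~ a.1, a.2).

Definition Vindex (n : nat) (a : bool * 'I_n) : 'I_(n + n) :=
  if a.1 then lshift n a.2 else rshift n a.2.

Lemma dualK n : involutive (@dual n).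
Proof. by case=> b j; rewrite /dual negbK. Qed.

Lemma Vindex_inj n : injective (@Vindex n).
Proof.
move=> [[] i] [[] j] /eqP; rewrite /Vindex /=.
- by rewrite eq_lshift => /eqP->.
- by rewrite eq_lrshift.
- by rewrite eq_rlshift.
- by rewrite eq_rshift => /eqP->.
Qed.

Lemma Vindex_surj n (k : 'I_(n + n)) : exists a, k = Vindex a.
Proof.
rewrite -(splitK k); case: (split k) => i; first by exists (true, i).
by exists (false, i).
Qed.

(** * The Clifford action of the basis vectors of V *)

Section Clifford.

Variables (F : fieldType) (n : nat).
Implicit Types (a c : bool * 'I_n) (s p q : ext F n) (x y : V F n).

(** Wedging with e_j and contracting with e_j^* are the same signed flip of j; they differ only in
    whether j must lie in the index of the target coordinate. One formula with a boolean covers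
    both. *)
Definition cliff a s : ext F n :=
  [ffun K : {set 'I_n} => if (a.2 \in K) == a.1 then sgn F a.2 K * s (flip a.2 K) else 0].

Lemma cliff_is_linear a : linear (cliff a).
Proof.
move=> c s t; apply/ffunP=> K; rewrite !ffunE.
case: ifP => _; last by rewrite scaler0 addr0.
by rewrite mulrDr /GRing.scale /= mulrCA.
Qed.
HB.instance Definition _ a :=
  GRing.isLinear.Build F (ext F n) (ext F n) _ (cliff a) (cliff_is_linear a).

(** For distinct indices the flips commute and exactly one of the two orders picks up a sign. For
    equal indices the two flips cancel: both orders vanish if the types agree, and otherwise exactly
    one order survives at each coordinate. *)
Lemma cliff_anticomm a c s :
  cliff a (cliff c s) + cliff c (cliff a s) = (c == dual a)%:R *: s.
Proof.
case: a c => [b i] [b' j]; apply/ffunP=> K; rewrite !ffunE /= !in_flip.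
rewrite /dual xpair_eqE /=.
have [->|ij] := eqVneq j i.
  rewrite andbT flipK !addbT sgn_flip_id /GRing.scale /=.
  by case: (i \in K) b b' => [] [] [] /=;
    rewrite ?mulr0 ?addr0 ?add0r ?mul0r ?mul1r // mulrA sgn_sqr mul1r.
rewrite andbF mulr0n scale0r !addbF flipC !sgn_flip.
case: (_ == b); case: (_ == b'); rewrite ?mulr0 ?addr0 //.
have -> : (j < i)%N = ~~ (i < j)%N.
  by rewrite -leqNgt [in RHS]leq_eqVlt val_eqE (negPf ij).
case: (i < j)%N; rewrite /= ?expr0 ?expr1; ring.
Qed.

Lemma rhoE x s : rho x s = \sum_a x 0 (Vindex a) *: cliff a s.
Proof.
apply/ffunP=> K; rewrite /rho !ffunE sum_ffunE.
rewrite (reindex_inj (can_inj (@dualK n))) /=.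
rewrite -(pair_bigA _ (fun b j => (x 0 (Vindex (dual (b, j))) *: cliff (dual (b, j)) s) K)) /=.
rewrite big_bool /= addrC; congr (_ + _).
  rewrite big_mkcond /=; apply: eq_bigr => j _; rewrite !ffunE /= mxE /Vindex /=.
  rewrite eqb_id; case: ifP => jK; last by rewrite scaler0.
  by rewrite flip_in // /GRing.scale /=; ring.
rewrite big_mkcond /=; apply: eq_bigr => j _; rewrite !ffunE /= mxE /Vindex /=.
rewrite eqbF_neg; case: ifP => jK; last by rewrite scaler0.
by rewrite flip_notin // /GRing.scale /=; ring.
Qed.

Lemma rho_is_linear x : linear (rho x).
Proof.
move=> c s t; rewrite !rhoE scaler_sumr -big_split; apply: eq_bigr => a _ /=.
by rewrite linearP scalerDr !scalerA mulrC.
Qed.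
HB.instance Definition _ x :=
  GRing.isLinear.Build F (ext F n) (ext F n) _ (rho x) (rho_is_linear x).

Lemma rhoZr x (r : F) s : rho x (r *: s) = r *: rho x s.
Proof. exact: linearZ. Qed.

Lemma rhoNr x s : rho x (- s) = - rho x s.
Proof. exact: linearN. Qed.

Lemma rhoDr x s p : rho x (s + p) = rho x s + rho x p.
Proof. exact: linearD. Qed.

Lemma rhoDl x y s : rho (x + y) s = rho x s + rho y s.
Proof.
rewrite !rhoE -big_split; apply: eq_bigr => a _ /=.
by rewrite mxE scalerDl.
Qed.

Lemma rhoZl (r : F) x s : rho (r *: x) s = r *: rho x s.
Proof.
rewrite !rhoE scaler_sumr; apply: eq_bigr => a _ /=.
by rewrite mxE scalerA.
Qed.

Lemma rhoNl x s : rho (- x) s = - rho x s.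
Proof. by rewrite -scaleN1r rhoZl scaleN1r. Qed.

Lemma rhoBl x y s : rho (x - y) s = rho x s - rho y s.
Proof. by rewrite rhoDl rhoNl. Qed.

Definition vec a : V F n := eb F (Vindex a).

Lemma vecE a c : vec a 0 (Vindex c) = (c == a)%:R.
Proof. by rewrite mxE eqxx (inj_eq (@Vindex_inj n)). Qed.

Lemma vec_sum x : x = \sum_a x 0 (Vindex a) *: vec a.
Proof.
apply/rowP=> k; have [c ->] := Vindex_surj k.
rewrite summxE (bigD1 c) //= mxE vecE eqxx mulr1 big1 ?addr0 // => a ac.
by rewrite mxE vecE eq_sym (negPf ac) mulr0.
Qed.

Definition Vof (f : bool * 'I_n -> F) : V F n := \sum_a f a *: vec a.

Lemma VofE f a : Vof f 0 (Vindex a) = f a.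
Proof.
rewrite summxE (bigD1 a) //= mxE vecE eqxx mulr1 big1 ?addr0 // => c ca.
by rewrite mxE vecE eq_sym (negPf ca) mulr0.
Qed.

Lemma rho_Vof f s : rho (Vof f) s = \sum_a f a *: cliff a s.
Proof. by rewrite rhoE; apply: eq_bigr => a _; rewrite VofE. Qed.

Lemma rho_vec a s : rho (vec a) s = cliff a s.
Proof.
rewrite rhoE (bigD1 a) //= vecE eqxx scale1r big1 ?addr0 // => c ca.
by rewrite vecE (negPf ca) scale0r.
Qed.

Lemma cliff_rho a x s :
  cliff a (rho x s) = x 0 (Vindex (dual a)) *: s - rho x (cliff a s).
Proof.
apply/eqP; rewrite eq_sym subr_eq eq_sym; apply/eqP.
rewrite !rhoE linear_sum -big_split (bigD1 (dual a)) //= [X in _ + X]big1 => [|c ca].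
  by rewrite addr0 linearZ -scalerDr cliff_anticomm eqxx scale1r.
by rewrite linearZ -scalerDr cliff_anticomm (negPf ca) scale0r scaler0.
Qed.

End Clifford.

(** Linearity is a hypothesis on a plain function, so that evaluation at a coordinate can be used
    directly as [f]. *)
Lemma span_scalar_eq0 (F : fieldType) (vT : vectType F) (X : seq vT)
    (f : vT -> F) :
  scalar f -> {in X, forall v, f v = 0} -> {in <<X>>%VS, forall v, f v = 0}.
Proof.
move=> lin_f fX v vX; rewrite (coord_span (X := in_tuple X) vX).
elim/big_rec: _ => [|i w _ fw].
  (* [f 0 = 0] follows from linearity at 0 = (-1) 0 + 0. *)
  by rewrite -[0 in LHS](addNr 0) -scaleN1r lin_f mulN1r addNr.
by rewrite lin_f fw fX ?mulr0 ?addr0 // mem_nth.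
Qed.

Lemma ffun_coord_scalar (F : fieldType) (T : finType) (t : T) :
  scalar (fun f : {ffun T -> F^o} => f t : F).
Proof. by move=> r f g; rewrite !ffunE. Qed.

(** * The symmetric form and the Clifford relations of arbitrary vectors *)

Section Form.

Variables (F : numFieldType) (n : nat).
Implicit Types (a c : bool * 'I_n) (s p q : ext F n) (x y z u : V F n).

Lemma form_coord x y :
  form x y *+ 2 = \sum_a x 0 (Vindex a) * y 0 (Vindex (dual a)).
Proof.
rewrite /form -mulrnAl -[2%:R^-1 *+ 2]mulr_natl divff ?pnatr_eq0 // mul1r.
rewrite -(pair_bigA _ (fun b j => x 0 (Vindex (b, j)) * y 0 (Vindex (dual (b, j))))) /=.
rewrite big_bool addrC; congr (_ + _); apply: eq_bigr => i _ /=;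
  by rewrite !mxE // mulrC.
Qed.

Lemma form_sum x y :
  form x y = 2%:R^-1 * \sum_a x 0 (Vindex a) * y 0 (Vindex (dual a)).
Proof. by rewrite -form_coord -[form _ _ *+ 2]mulr_natl mulKf ?pnatr_eq0. Qed.

Lemma formC x y : form x y = form y x.
Proof. by rewrite /form addrC. Qed.

Lemma formDl x y z : form (x + y) z = form x z + form y z.
Proof.
rewrite !form_sum -mulrDr -big_split; congr (_ * _).
by apply: eq_bigr => a _; rewrite mxE mulrDl.
Qed.

Lemma formZl (r : F) x y : form (r *: x) y = r * form x y.
Proof.
rewrite !form_sum mulrCA; congr (_ * _).
by rewrite mulr_sumr; apply: eq_bigr => a _; rewrite mxE mulrA.
Qed.

Lemma formNl x y : form (- x) y = - form x y.
Proof. by rewrite -scaleN1r formZl mulN1r. Qed.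

Lemma formDr x y z : form x (y + z) = form x y + form x z.
Proof. by rewrite formC formDl !(formC _ x). Qed.

Lemma formZr (r : F) x y : form x (r *: y) = r * form x y.
Proof. by rewrite formC formZl (formC y). Qed.

Lemma formNr x y : form x (- y) = - form x y.
Proof. by rewrite formC formNl (formC y). Qed.

Definition formE := (formDl, formDr, formNl, formNr, formZl, formZr).

Lemma form_vecl a x : form (vec F a) x = 2%:R^-1 * x 0 (Vindex (dual a)).
Proof.
rewrite form_sum (bigD1 a) //= vecE eqxx mul1r big1 ?addr0 // => c ca.
by rewrite vecE (negPf ca) mul0r.
Qed.

Lemma form_vec a c :
  form (vec F a) (vec F c) = 2%:R^-1 * ((a.1 != c.1) && (a.2 == c.2))%:R.
Proof.
by rewrite form_vecl vecE -pair_eqE /pair_eq /=; case: a.1; case: c.1.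
Qed.

Lemma rho_anticomm x y s :
  rho x (rho y s) + rho y (rho x s) = (form x y *+ 2) *: s.
Proof.
rewrite form_coord scaler_suml [X in X + _]rhoE [rho x s]rhoE linear_sum -big_split.
apply: eq_bigr => a _ /=.
by rewrite cliff_rho scalerBr scalerA rhoZr subrK.
Qed.

Lemma rho_sqr x s : rho x (rho x s) = form x x *: s.
Proof.
have /eqP := rho_anticomm x x s; rewrite -mulr2n -scaler_nat -[form x x *+ 2]mulr_natl.
by rewrite -scalerA => /eqP /(scalerI _); apply; rewrite pnatr_eq0.
Qed.

Lemma rho_unitK x : form x x = 1 -> involutive (rho x).
Proof. by move=> x1 s; rewrite rho_sqr x1 scale1r. Qed.

End Form.

(** * Tensors of spinors *)

Section Tensor.

Variables (F : fieldType) (n : nat).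
Implicit Types (p q s : ext F n) (T : ext2 F n) (g h : {linear ext F n -> ext F n}).

Lemma tensDl p q s : tens (p + q) s = tens p s + tens q s.
Proof. by apply/ffunP=> J; rewrite !ffunE mulrDl. Qed.

Lemma tensDr p q s : tens s (p + q) = tens s p + tens s q.
Proof. by apply/ffunP=> J; rewrite !ffunE mulrDr. Qed.

Lemma tensZl (r : F) p q : tens (r *: p) q = r *: tens p q.
Proof. by apply/ffunP=> J; rewrite !ffunE /GRing.scale /= mulrA. Qed.

Lemma tensZr (r : F) p q : tens p (r *: q) = r *: tens p q.
Proof. by apply/ffunP=> J; rewrite !ffunE /GRing.scale /= mulrCA. Qed.

Lemma tensNr p q : tens p (- q) = - tens p q.
Proof. by rewrite -scaleN1r tensZr scaleN1r. Qed.

Lemma tens0l q : tens 0 q = 0.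
Proof. by rewrite -(scale0r 0) tensZl !scale0r. Qed.

Lemma tens0r p : tens p 0 = 0.
Proof. by rewrite -(scale0r 0) tensZr !scale0r. Qed.

Lemma tens_suml (I : Type) (r : seq I) (P : pred I) (f : I -> ext F n) q :
  tens (\sum_(i <- r | P i) f i) q = \sum_(i <- r | P i) tens (f i) q.
Proof.
by apply: (big_morph (fun p => tens p q)) => [p p'|]; rewrite ?tensDl ?tens0l.
Qed.

Lemma tens_sumr (I : Type) (r : seq I) (P : pred I) (f : I -> ext F n) p :
  tens p (\sum_(i <- r | P i) f i) = \sum_(i <- r | P i) tens p (f i).
Proof.
by apply: (big_morph (fun q => tens p q)) => [q q'|]; rewrite ?tensDr ?tens0r.
Qed.

Lemma vb_sum p : p = \sum_J (p J : F) *: vb F J.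
Proof.
apply/ffunP=> K; rewrite sum_ffunE (bigD1 K) //= !ffunE eqxx big1 => [|J JK].
  by rewrite addr0 /GRing.scale /= mulr1.
by rewrite !ffunE eq_sym (negPf JK) scaler0.
Qed.

Lemma tens_vb_sum T : T = \sum_J \sum_K (T (J, K) : F) *: tens (vb F J) (vb F K).
Proof.
apply/ffunP=> -[J K]; rewrite sum_ffunE (bigD1 J) //= sum_ffunE (bigD1 K) //=.
rewrite !ffunE /= !eqxx mulr1 /GRing.scale /= mulr1.
rewrite big1 => [|L LK]; last first.
  by rewrite !ffunE /= (eq_sym K) (negPf LK) mulr0 scaler0.
rewrite big1 ?addr0 // => L LJ; rewrite sum_ffunE big1 // => M _.
by rewrite !ffunE /= (eq_sym J) (negPf LJ) mul0r scaler0.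
Qed.

Lemma tensmap_is_linear (g h : ext F n -> ext F n) : linear (tensmap g h).
Proof.
move=> r T U; rewrite /tensmap scaler_sumr -big_split; apply: eq_bigr => J _ /=.
rewrite scaler_sumr -big_split; apply: eq_bigr => K _ /=.
by rewrite !ffunE scalerDl scalerA.
Qed.
HB.instance Definition _ g h :=
  GRing.isLinear.Build F (ext2 F n) (ext2 F n) _ (tensmap g h)
    (tensmap_is_linear g h).

Lemma tensmap_tens g h p q : tensmap g h (tens p q) = tens (g p) (h q).
Proof.
rewrite [in RHS](vb_sum p) [in RHS](vb_sum q) !linear_sum tens_suml.
apply: eq_bigr => J _ /=; rewrite tens_sumr; apply: eq_bigr => K _ /=.
by rewrite !ffunE !linearZ /= tensZl tensZr scalerA.
Qed.

Lemma tensmap_id T : tensmap id id T = T.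
Proof. by rewrite [RHS]tens_vb_sum. Qed.

End Tensor.

(** * The incidence equation and its invariance *)

Section Incidence.

Variables (F : numFieldType) (n : nat).
Implicit Types (a c : bool * 'I_n) (s p q : ext F n) (x y z u : V F n).
Implicit Types (I J K : {set 'I_n}).

Definition omega p q : ext2 F n :=
  \sum_a tens (cliff a p) (cliff (dual a) q).

(* The equations of the pairs of pure spinors whose annihilators in V meet in
   dimension n - 1. *)
Definition incident p q := omega p q = tens q p.

(** Wedging on one factor is paired with contraction on the other, so j contributes only if it lies
    in exactly one of J and K. *)
Lemma omega_coord p q J K : omega p q (J, K) =
  \sum_(j | (j \in J) != (j \in K))
    sgn F j J * sgn F j K * ((p (flip j J) : F) * q (flip j K)).
Proof.
rewrite sum_ffunE.
under eq_bigr => a _ do rewrite !ffunE /=.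
rewrite (eq_bigr (fun a => (fun b j =>
  if (j \in J) == b then if (j \in K) != b then
    sgn F j J * sgn F j K * ((p (flip j J) : F) * q (flip j K)) else 0 else 0)
     a.1 a.2)); last first.
  by move=> [b j] _ /=; case: b (j \in J) (j \in K) => [] [] [] /=; ring.
rewrite -(pair_bigA _ (fun b j => if (j \in J) == b then if (j \in K) != b then
    sgn F j J * sgn F j K * ((p (flip j J) : F) * q (flip j K)) else 0 else 0)).
rewrite big_bool /= -big_split [RHS]big_mkcond /=; apply: eq_bigr => j _.
by case: (j \in J); case: (j \in K); rewrite /= ?addr0 ?add0r.
Qed.

Lemma incidentC p q : incident p q -> incident q p.
Proof.
move=> pq; apply/ffunP=> -[J K]; have /ffunP/(_ (K, J)) := pq.
rewrite !omega_coord !ffunE /= [X in _ = X]mulrC => <-.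
by under eq_bigl do rewrite eq_sym; apply: eq_bigr => j _; ring.
Qed.

Lemma incidentZ (r t : F) p q : incident p q -> incident (r *: p) (t *: q).
Proof.
rewrite /incident tensZl tensZr => <-; rewrite !scaler_sumr.
apply: eq_bigr => a _.
by rewrite !linearZ /= tensZl tensZr !scalerA mulrC.
Qed.

(** [omega] commutes with the action of x on both factors. Moving [rho x] past each basis vector
    leaves three correction sums: 2<x, x> from the product of coordinates, and -<x, x> from each of
    the two mixed sums, which reassemble [rho x] applied twice. They cancel. *)
Lemma incident_rho x p q : incident p q -> incident (rho x p) (rho x q).
Proof.
move=> pq; rewrite /incident -(tensmap_tens (rho x) (rho x)) -pq.
rewrite /omega linear_sum /=.
under [RHS]eq_bigr do rewrite tensmap_tens.
rewrite (eq_bigr (fun a => x 0 (Vindex a) * x 0 (Vindex (dual a)) *: tens p q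
  - x 0 (Vindex (dual a)) *: tens p (rho x (cliff (dual a) q))
  - x 0 (Vindex a) *: tens (rho x (cliff a p)) q
  + tens (rho x (cliff a p)) (rho x (cliff (dual a) q)))); last first.
  move=> a _; rewrite !cliff_rho dualK.
  move: (rho x _) (rho x _) => p' q'.
  by apply/ffunP=> -[J K]; rewrite !ffunE /GRing.scale /=; ring.
rewrite 3!big_split /= !sumrN -[RHS]add0r; congr (_ + _).
rewrite -scaler_suml -form_coord -(reindex_inj (can_inj (@dualK n)) (P := predT)
  (F := fun a => x 0 (Vindex a) *: tens p (rho x (cliff a q)))) /=.
under [X in _ - X - _]eq_bigr do rewrite -tensZr -rhoZr.
under [X in _ - X]eq_bigr do rewrite -tensZl -rhoZr.
rewrite -tens_suml -tens_sumr -!(linear_sum (rho x)) -!rhoE.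
by rewrite /= !rho_sqr tensZl tensZr mulr2n scalerDl addrK subrr.
Qed.

(** The hypothesis is the pure spinor equation. Apply x to its second factor: moving x past the dual
    basis vectors produces the sum of x_a e_a p, which is [rho x p], tensored with p. *)
Lemma incident_rho_self p x : omega p p = 0 -> incident p (rho x p).
Proof.
move=> pp; have {pp} : tensmap (@idfun (ext F n)) (rho x) (omega p p) = 0.
  by rewrite pp linear0.
rewrite linear_sum /=; under eq_bigr do rewrite tensmap_tens /=.
move=> pp; rewrite /incident /omega -[LHS]addr0 -[X in _ + X]pp -big_split [in RHS]rhoE tens_suml.
apply: eq_bigr => a _ /=.
by rewrite cliff_rho dualK tensDr tensNr tensZr tensZl subrK.
Qed.

Lemma cliff_vac (j : 'I_n) : cliff (false, j) (vb F finset.set0) = 0 :> ext F n.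
Proof.
apply/ffunP=> K; rewrite !ffunE /=; case: ifP => // /eqP jK.
have /negPf-> : flip j K != finset.set0; last by rewrite mulr0.
by apply/set0Pn; exists j; rewrite in_flip jK eqxx.
Qed.

Lemma omega_vac : omega (vb F (finset.set0 : {set 'I_n})) (vb F finset.set0) = 0.
Proof.
by rewrite /omega big1 // => -[[] j] _ /=; rewrite cliff_vac ?tens0l ?tens0r.
Qed.

(** This is the coordinate of the incidence equation at (I + e_j + e_k + e_l, I). The two sets
    differ in j, k, l only, so three terms remain, and the order j < k < l makes their signs
    alternate. *)
Lemma incident_cube p q (j k l : 'I_n) I : incident p q -> (j < k < l)%N ->
    j \notin I -> k \notin I -> l \notin I ->
  (p (k |: (l |: I)) : F) * q (j |: I) - (p (j |: (l |: I)) : F) * q (k |: I)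
    + (p (j |: (k |: I)) : F) * q (l |: I)
  = (q (j |: (k |: (l |: I))) : F) * p I.
Proof.
move=> pq /andP[jk kl] jI kI lI.
have jNk : j != k by rewrite -val_eqE /= neq_ltn jk.
have kNl : k != l by rewrite -val_eqE /= neq_ltn kl.
have jNl : j != l by rewrite -val_eqE /= neq_ltn (ltn_trans jk kl).
rewrite -!flip_notin ?in_flip ?(negPf jNk) ?(negPf jNl) ?(negPf kNl) ?addbF //.
have /ffunP/(_ (flip j (flip k (flip l I)), I)) := pq.
rewrite omega_coord [RHS]ffunE /= => <-.
rewrite (bigD1 j) /=; last by rewrite !in_flip eqxx (negPf jI) (negPf jNk) (negPf jNl).
rewrite (bigD1 k) /=; last first.
  by rewrite !in_flip eqxx (negPf kI) (eq_sym k j) (negPf jNk) (negPf kNl).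
rewrite (bigD1 l) /=; last first.
  by rewrite !in_flip eqxx (negPf lI) !(eq_sym l) (negPf jNl) (negPf kNl).
rewrite big1 => [|i /andP[/andP[/andP[]]]]; last first.
  rewrite !in_flip => + /negPf ij /negPf ik /negPf il.
  by rewrite ij ik il !addbF eqxx.
rewrite flipK (flipC k j) flipK (flipC l j) (flipC l k) flipK.
have jl := ltn_trans jk kl.
rewrite !sgn_flip !ltnn jk kl jl (ltnNge k j) (ltnNge l j) (ltnNge l k).
rewrite (ltnW jk) (ltnW kl) (ltnW jl) /=.
have := sgn_sqr F j I; have := sgn_sqr F k I; have := sgn_sqr F l I.
move: (sgn F j I) (sgn F k I) (sgn F l I) => sj sk sl El Ek Ej.
by rewrite !(expr0, expr1, mul1r, mulN1r, mulNr, opprK) El Ek Ej !mul1r addr0 addrA.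
Qed.

(** The action of exp(r e_i e_j): the exponential series stops here because e_i e_j squares to
    zero. *)
Definition unipotent (i j : 'I_n) (r : F) s : ext F n :=
  s + r *: cliff (true, i) (cliff (true, j) s).

(* With u = e_j + e_j^* and w = e_j - e_j^*, the product
   (u + t e_i) u (w - t e_i) w is - (1 + 2 t e_i e_j). *)
Lemma incident_unipotent i j r p q : i != j ->
  incident p q -> incident (unipotent i j r p) (unipotent i j r q).
Proof.
move=> ij pq; pose t := r / 2%:R.
pose u := vec F (true, j) + vec F (false, j).
pose w := vec F (true, j) - vec F (false, j).
pose x := vec F (true, i).
have E s : unipotent i j r s =
    -1 *: rho (u + t *: x) (rho u (rho (w - t *: x) (rho w s))).
  have uu : form u u = 1.
    by rewrite !formE !form_vec /= eqxx /=; field.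
  have ww : form w w = -1.
    by rewrite !formE !form_vec /= eqxx /=; field.
  have xx : form x x = 0 by rewrite form_vec mulr0.
  have ux : form u x = 0.
    by rewrite !formE !form_vec /= eq_sym (negPf ij) !mulr0 addr0.
  have {ux} ux v : rho u (rho x v) = - rho x (rho u v).
    by apply/eqP; rewrite -addr_eq0 rho_anticomm ux mul0rn scale0r.
  have -> v : rho (u + t *: x) (rho u v) = v + t *: rho x (rho u v).
    by rewrite rhoDl rhoZl rho_sqr uu scale1r.
  have -> : rho (w - t *: x) (rho w s) = - s - t *: rho x (rho w s).
    by rewrite rhoBl rhoZl rho_sqr ww scaleN1r.
  rewrite (rhoDr u (- s)) 2!(rhoNr u) (rhoZr u) ux scalerN opprK.
  rewrite (rhoDr x (- rho u s)) (rhoNr x) (rhoZr x) (rho_sqr x) xx scale0r.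
  rewrite scaler0 addr0 /unipotent.
  rewrite -!rho_vec (_ : vec F (true, j) = 2%:R^-1 *: (u + w)); last first.
    rewrite addrACA subrr addr0 -mulr2n -scaler_nat scalerA mulVf ?scale1r //.
    by rewrite pnatr_eq0.
  rewrite rhoZl (rhoZr x) rhoDl (rhoDr x (rho u s)) scalerA -/t scaleN1r !(opprD, opprK, scalerN).
  by rewrite scalerDr -addrA [X in _ + X]addrC.
by rewrite !E; apply: incidentZ; do 4!apply: incident_rho.
Qed.

End Incidence.

(** * Half-spin spaces and parity *)

Section Parity.

Variables (F : fieldType) (n : nat).
Implicit Types (s p q : ext F n) (J K : {set 'I_n}) (b : bool).

Lemma halfspinP b s :
  reflect (forall J, odd #|J| != b -> s J = 0) (s \in halfspin F n b).
Proof.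
apply: (iffP idP) => [sb J Jb|s0].
  apply: (span_scalar_eq0 (@ffun_coord_scalar F _ J)) sb => _ /mapP[K + ->].
  rewrite mem_filter => /andP[/eqP Kb _]; rewrite ffunE.
  by case: eqP => // JK; move: Jb; rewrite JK Kb eqxx.
rewrite (vb_sum s); apply: memv_suml => J _.
have [Jb|/s0->] := eqVneq (odd #|J|) b; last by rewrite scale0r mem0v.
by apply/memvZ/memv_span/map_f; rewrite mem_filter Jb eqxx mem_enum.
Qed.

Lemma rho_halfspin (x : V F n) b s :
  s \in halfspin F n b -> rho x s \in halfspin F n (~~ b).
Proof.
move=> /halfspinP sb; apply/halfspinP=> J Jb; rewrite rhoE sum_ffunE big1 // => a _.
rewrite !ffunE sb ?mulr0 ?if_same ?scaler0 // odd_flip.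
by apply: contraNneq Jb => <-; rewrite negbK.
Qed.

Lemma parity_part_halfspin b s : parity_part b s \in halfspin F n b.
Proof. by apply/halfspinP=> J /negPf Jb; rewrite ffunE Jb. Qed.

Lemma parity_part_add b p q :
    p \in halfspin F n false -> q \in halfspin F n true ->
  parity_part b (p + q) = if b then q else p.
Proof.
move=> /halfspinP p0 /halfspinP q0; apply/ffunP=> J; rewrite !ffunE.
case oJ: (odd #|J|); case: b => /=.
- by rewrite (p0 J) ?oJ // add0r.
- by rewrite (p0 J) ?oJ.
- by rewrite (q0 J) ?oJ.
- by rewrite (q0 J) ?oJ // addr0.
Qed.

End Parity.

(** * Solutions of the cube equations and incident pairs *)

Section Y0.

Variables (F : numFieldType) (n : nat).
Implicit Types (s p q x : ext F n) (I J K : {set 'I_n}).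
Local Notation Splus := (halfspin F n false).
Local Notation Sminus := (halfspin F n true).
Local Notation O := (finset.set0 : {set 'I_n}).

(** Depending on the parity of I, only one of p and q contributes to each factor, and the equation
    is [incident_cube] for (p, q) or for (q, p). *)
Lemma incident_cube_sum p q : p \in Splus -> q \in Sminus -> incident p q ->
  forall (j k l : 'I_n) I, (j < k < l)%N -> j \notin I -> k \notin I -> l \notin I ->
  ((p + q) I : F) * (p + q) (j |: (k |: (l |: I)))
    + ((p + q) (j |: (l |: I)) : F) * (p + q) (k |: I)
  = ((p + q) (j |: (k |: I)) : F) * (p + q) (l |: I)
    + ((p + q) (k |: (l |: I)) : F) * (p + q) (j |: I).
Proof.
move=> /halfspinP pS /halfspinP qS pq j k l I jkl jI kI lI.
have /andP[jk kl] := jkl.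
have jNk : j != k by rewrite -val_eqE /= neq_ltn jk.
have kNl : k != l by rewrite -val_eqE /= neq_ltn kl.
have jNl : j != l by rewrite -val_eqE /= neq_ltn (ltn_trans jk kl).
have E1 := incident_cube pq jkl jI kI lI.
have E2 := incident_cube (incidentC pq) jkl jI kI lI.
move: E1 E2; rewrite !ffunE.
rewrite -!flip_notin ?in_flip ?(negPf jNk) ?(negPf jNl) ?(negPf kNl) ?addbF //.
case oI: (odd #|I|).
  rewrite (pS I) ?oI // (pS (flip j (flip k I))) ?odd_flip ?oI //.
  rewrite (pS (flip j (flip l I))) ?odd_flip ?oI //.
  rewrite (pS (flip k (flip l I))) ?odd_flip ?oI //.
  rewrite (qS (flip l I)) ?odd_flip ?oI // (qS (flip k I)) ?odd_flip ?oI //.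
  rewrite (qS (flip j I)) ?odd_flip ?oI //.
  rewrite (qS (flip j (flip k (flip l I)))) ?odd_flip ?oI //.
  by rewrite !add0r !addr0 => _ E; rewrite mulrC -E; ring.
rewrite (qS I) ?oI // (qS (flip j (flip k I))) ?odd_flip ?oI //.
rewrite (qS (flip j (flip l I))) ?odd_flip ?oI //.
rewrite (qS (flip k (flip l I))) ?odd_flip ?oI //.
rewrite (pS (flip l I)) ?odd_flip ?oI // (pS (flip k I)) ?odd_flip ?oI //.
rewrite (pS (flip j I)) ?odd_flip ?oI //.
rewrite (pS (flip j (flip k (flip l I)))) ?odd_flip ?oI //.
by rewrite !add0r !addr0 => E _; rewrite mulrC -E; ring.
Qed.

Lemma incident_Y0 p q : p \in Splus -> q \in Sminus -> incident p q ->
  (forall J, (p + q) J != 0) -> Y0 (p + q).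
Proof. by move=> pS qS pq; split=> //; apply: incident_cube_sum. Qed.

Lemma sgn_set0 (j : 'I_n) : sgn F j O = 1.
Proof. by rewrite sgnE big1 // => k _; rewrite inE. Qed.

Lemma unipotent_coord (i j : 'I_n) r s K : i != j ->
  unipotent i j r s K = s K + (if (i \in K) && (j \in K) then
    r * (sgn F i K * sgn F j (flip i K)) * s (flip j (flip i K)) else 0).
Proof.
move=> ij; rewrite !ffunE /= !in_flip (eq_sym j) (negPf ij) addbF !eqb_id.
case: (i \in K); case: (j \in K); rewrite /= ?mulr0 ?scaler0 //.
by rewrite /GRing.scale /= !mulrA.
Qed.

(** Start from x_O times the vacuum and a vector u of W carrying the degree 1 coordinates. Each
    [unipotent i j r] alters only coordinates whose index contains both i and j, so the degree 2
    coordinates can be adjusted one pair at a time, which is the induction on the list of pairs. *)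
Lemma incident_prescribed x : x O != 0 -> exists p q,
  [/\ p \in Splus, q \in Sminus, incident p q & [/\ p O = x O,
    forall i : 'I_n, q (flip i O) = x (flip i O)
    & forall i j : 'I_n, (i < j)%N -> p (flip i (flip j O)) = x (flip i (flip j O))]].
Proof.
move=> xO.
suff [p [q [pS qS pq [pO q1 p2]]]] : exists p q,
  [/\ p \in Splus, q \in Sminus, incident p q & [/\ p O = x O,
    forall i : 'I_n, q (flip i O) = x (flip i O)
    & forall ij, ij \in enum {: 'I_n * 'I_n} -> (ij.1 < ij.2)%N ->
       p (flip ij.1 (flip ij.2 O)) = x (flip ij.1 (flip ij.2 O))]].
  exists p, q; split=> //; split=> // i j ij.
  by apply: (p2 (i, j)); rewrite ?mem_enum.
elim: (enum _) => [|[i j] ijs [p [q [pS qS pq [pO q1 p2]]]]].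
  pose u : V F n := Vof (fun a => if a.1 then x (flip a.2 O) else 0).
  have vS : vb F O \in Splus.
    apply/halfspinP=> J Jb; rewrite ffunE; case: eqP => // JO.
    by move: Jb; rewrite JO cards0.
  exists (x O *: vb F O), (rho u (vb F O)); split.
  - exact: memvZ.
  - exact: (@rho_halfspin F n u false).
  - rewrite -[rho u _]scale1r; apply: incidentZ; apply: incident_rho_self.
    exact: omega_vac.
  split=> // [|i]; first by rewrite !ffunE eqxx /GRing.scale /= mulr1.
  rewrite rho_Vof sum_ffunE (bigD1 (true, i)) //= big1 => [|[[] j] ij]; last first.
  - by rewrite scale0r ffunE.
  - rewrite !ffunE /= in_flip inE /=; case: (j =P i) => ji; last by rewrite scaler0.
    by rewrite ji eqxx in ij.
  rewrite !ffunE /= in_flip inE !eqxx flipK sgn_flip_id sgn_set0 mul1r eqxx.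
  by rewrite addr0 /GRing.scale /= mulr1.
have [ij|] := ltnP i j; last first.
  move=> ji; exists p, q; split=> //; split=> // kl; rewrite inE => /predU1P[->|/p2] //.
  by rewrite /= ltnNge ji.
have iNj : i != j by rewrite -val_eqE /= neq_ltn ij.
(* The coordinate at {i, j} grows by r times the vacuum coordinate of p, which is x_O. *)
pose r := (x (flip i (flip j O)) - p (flip i (flip j O))) / x O.
exists (unipotent i j r p), (unipotent i j r q).
have uS b s : s \in halfspin F n b -> unipotent i j r s \in halfspin F n b.
  move=> sS; apply: memvD => //; apply: memvZ; rewrite -!rho_vec -[b]negbK.
  by do 2!apply: rho_halfspin.
split; [exact: uS | exact: uS | exact: incident_unipotent |].
split=> [|k|[k l]].
- by rewrite unipotent_coord // inE addr0.
- rewrite unipotent_coord // !in_flip !inE /=.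
  case: eqP => [<-|_] /=; last by rewrite addr0.
  by rewrite eq_sym (negPf iNj) addr0.
rewrite inE /= => klP kl; rewrite unipotent_coord // !in_flip !inE /=.
have [[-> ->]|klN] := eqVneq (k, l) (i, j).
  rewrite !eqxx (eq_sym j) (negPf iNj) /= !flipK sgn_flip_id sgn_flip sgn_set0.
  rewrite ltnNge (ltnW ij) expr0 mul1r sgn_flip_id sgn_set0 !mulr1 pO /r.
  by rewrite divfK // addrC subrK.
(* Both pairs are increasing, so {k, l} contains i and j only if the pairs agree. *)
rewrite ifF; last first.
  apply/negP=> /andP[].
  case: (i =P l) => [il|_]; case: (i =P k) => [ik|_] //= _.
    case: (j =P l) => [jl|_]; first by rewrite il jl eqxx in iNj.
    by case: (j =P k) => // jk; rewrite il jk ltnNge (ltnW kl) in ij.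
  case: (j =P l) => [jl|_]; first by rewrite ik jl eqxx in klN.
  by case: (j =P k) => // jk; rewrite ik jk eqxx in iNj.
rewrite addr0; move: klP; rewrite (negPf klN) /= => klP.
exact: (p2 (k, l)).
Qed.

Lemma set_min_elt J : J != O -> exists2 j, j \in J & forall i, i \in J :\ j -> (j < i)%N.
Proof.
case/set0Pn=> j0 j0J; case: (arg_minnP (fun j : 'I_n => val j) j0J) => j jJ jmin.
exists j => // i; rewrite !inE => /andP[ij iJ].
by rewrite ltn_neqAle jmin // andbT eq_sym val_eqE.
Qed.

(* On the solutions of the cube equations without zero coordinate, all the
   coordinates are functions of those indexed by sets of at most 2 elements. *)
Lemma Y0_determined x p q :
    p \in Splus -> q \in Sminus -> incident p q -> Y0 x ->
    p O = x O -> (forall i : 'I_n, q (flip i O) = x (flip i O)) ->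
    (forall i j : 'I_n, (i < j)%N -> p (flip i (flip j O)) = x (flip i (flip j O))) ->
  p + q = x.
Proof.
move=> pS qS pq [xN0 xcube] pO q1 p2; have ycube := incident_cube_sum pS qS pq.
move/halfspinP: pS => pS; move/halfspinP: qS => qS; set y := p + q in ycube *.
(* Induction on the cardinality. A set with at least three elements is I + e_j + e_k + e_l with j,
   k, l its smallest elements; the cube equation at I, divided by x_I, expresses its coordinate
   through those of smaller sets. *)
apply/ffunP=> J; have [m] := ubnP #|J|; elim: m J => // m IHm J Jm.
have [->|/set_min_elt[j jJ jmin]] := eqVneq J O.
  by rewrite ffunE pO qS ?addr0 ?cards0.
rewrite -(setD1K jJ) in Jm *; move: (J :\ j) (setD11 j J) jmin Jm => {jJ}J jJ jmin Jm.
have [->|/set_min_elt[k kJ kmin]] := eqVneq J O.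
  by rewrite -flip_notin ?inE // ffunE q1 pS ?add0r ?odd_flip ?cards0.
have jk := jmin k kJ.
have {jmin} jmin i : i \in J :\ k -> (j < i)%N by rewrite inE => /andP[_ /jmin].
rewrite -(setD1K kJ) in jJ Jm *.
move: (J :\ k) (setD11 k J) jmin kmin jJ Jm => {kJ}J kJ jmin kmin jJ Jm.
have [J0|/set_min_elt[l lJ lmin]] := eqVneq J O.
  rewrite J0 -(@flip_notin _ k) ?inE // -flip_notin.
    by rewrite ffunE p2 // qS ?addr0 ?odd_flip ?cards0.
  by move: jJ; rewrite J0 in_flip !inE orbF => ->.
have kl := kmin l lJ.
rewrite -(setD1K lJ) in kJ jJ Jm *.
move: (J :\ l) (setD11 l J) kJ jJ Jm => I /negbT lI kJ jJ Jm.
have jI : j \notin I by apply: contraFN jJ; rewrite !inE => ->; rewrite !orbT.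
have kI : k \notin I by apply: contraFN kJ; rewrite !inE => ->; rewrite !orbT.
have jkl : (j < k < l)%N by rewrite jk.
have IH K : (#|K| < #|j |: (k |: (l |: I))|)%N -> y K = x K.
  by move=> KJ; apply: IHm; apply: leq_trans KJ _.
have cJ : #|j |: (k |: (l |: I))| = #|I|.+3 by rewrite !cardsU1 jJ kJ lI.
have := ycube j k l I jkl jI kI lI; have := xcube j k l I jkl jI kI lI.
have c1 i : (#|i |: I| <= #|I|.+1)%N by rewrite cardsU1; case: (_ \notin _).
have c2 i i' : (#|i |: (i' |: I)| <= #|I|.+2)%N.
  rewrite cardsU1; apply: leq_trans (leq_add (leq_b1 _) (c1 i')) _ => //.
rewrite !(IH (_ |: I)) ?cJ ?ltnS ?(leq_trans (c1 _)) //.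
rewrite !(IH (_ |: (_ |: I))) ?cJ ?ltnS ?c2 // (IH I) ?cJ ?ltnS ?leqW //.
move=> <- /addIr /(mulfI (xN0 I)).
by [].
Qed.

(** The solution coincides with the incident pair having the same coordinates of degree at most 2,
    and its parity parts are the members of that pair. *)
Lemma Y0_incident x : Y0 x ->
  incident (parity_part false x) (parity_part true x).
Proof.
move=> xY; have [xN0 _] := xY.
have [p [q [pS qS pq [pO q1 p2]]]] := incident_prescribed (xN0 O).
have <- := Y0_determined pS qS pq xY pO q1 p2.
by rewrite !parity_part_add.
Qed.

End Y0.

(** * Reflections of V and products of unit vectors acting on spinors *)

Section Reflections.

Variables (F : numFieldType) (n : nat).
Implicit Types (w x y z v : V F n) (ws : seq (V F n)).

Definition unitv ws := {in ws, forall w, form w w = 1}.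

Lemma unitv_cons w ws : unitv (w :: ws) <-> form w w = 1 /\ unitv ws.
Proof.
split=> [ww|[ww1 ww] x]; last by rewrite inE => /predU1P[->|/ww].
by split=> [|x xw]; apply: ww; rewrite inE ?eqxx ?xw ?orbT.
Qed.

Lemma unitv_cat ws ws' : unitv ws -> unitv ws' -> unitv (ws ++ ws').
Proof. by move=> u u' x; rewrite mem_cat => /orP[/u|/u']. Qed.

Definition refl w y : V F n := y - (form w y *+ 2) *: w.

Definition refls ws y : V F n := foldr refl y ws.

Lemma refls_cons w ws y : refls (w :: ws) y = refl w (refls ws y).
Proof. by []. Qed.

Lemma refl_is_linear w : linear (refl w).
Proof.
move=> r x y; rewrite /refl formDr formZr mulrnDl scalerDl opprD addrACA scalerBr.
by rewrite scalerA mulrnAr.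
Qed.

Lemma refls_is_linear ws : linear (refls ws).
Proof. by elim: ws => // w ws IH r x y; rewrite !refls_cons IH refl_is_linear. Qed.
HB.instance Definition _ ws :=
  GRing.isLinear.Build F (V F n) (V F n) _ (refls ws) (refls_is_linear ws).

Lemma form_refl w y z : form w w = 1 -> form (refl w y) (refl w z) = form y z.
Proof. by move=> ww; rewrite /refl !formE (formC y w) ww; ring. Qed.

Lemma reflK w : form w w = 1 -> involutive (refl w).
Proof.
move=> ww y; rewrite {1}/refl (_ : form w (refl w y) = - form w y).
  by rewrite mulNrn scaleNr opprK subrK.
by rewrite /refl !formE ww; ring.
Qed.

Lemma form_refls ws y z : unitv ws -> form (refls ws y) (refls ws z) = form y z.
Proof.
elim: ws => // w ws IH /unitv_cons[ww uws].
by rewrite !refls_cons form_refl // IH.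
Qed.

Lemma refls_inj ws : unitv ws -> injective (refls ws).
Proof.
elim: ws => [_ y z //|w ws IH /unitv_cons[ww uws] y z].
by rewrite !refls_cons; move/(can_inj (reflK ww))/(IH uws).
Qed.

Lemma refls_cat ws ws' y : refls (ws ++ ws') y = refls ws (refls ws' y).
Proof. exact: foldr_cat. Qed.

Lemma refl_fix w y : form w y = 0 -> refl w y = y.
Proof. by rewrite /refl => ->; rewrite mul0rn scale0r subr0. Qed.

(* The action of rho w by conjugation is minus the reflection along w. *)
Definition conjs ws y : V F n := foldr (fun w y => - refl w y) y ws.

Lemma conjsE ws y : conjs ws y = (-1) ^+ size ws *: refls ws y.
Proof.
elim: ws => [|w ws IH] /=; first by rewrite expr0 scale1r.
rewrite -/(conjs ws y) IH exprS mulN1r scaleNr; congr (- _).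
by rewrite /refl formZr scalerBr scalerA mulrnAr.
Qed.

Definition spinact ws (s : ext F n) : ext F n := foldr (@rho F n) s ws.

Lemma spinact_cons w ws s : spinact (w :: ws) s = rho w (spinact ws s).
Proof. by []. Qed.

Lemma spinact_is_linear ws : linear (spinact ws).
Proof. by elim: ws => // w ws IH r x y; rewrite !spinact_cons IH linearP. Qed.
HB.instance Definition _ ws :=
  GRing.isLinear.Build F (ext F n) (ext F n) _ (spinact ws) (spinact_is_linear ws).

Lemma spinact_cat ws ws' s : spinact (ws ++ ws') s = spinact ws (spinact ws' s).
Proof. exact: foldr_cat. Qed.

Lemma spin_spinact ws : ~~ odd (size ws) -> unitv ws -> spin (spinact ws).
Proof. by move=> ? ?; exists ws; split. Qed.

Lemma spin_vector_conjs ws : unitv ws -> spin_vector (spinact ws) (conjs ws).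
Proof.
elim: ws => // w ws IH /unitv_cons[ww uws] x s /=.
rewrite -/(conjs ws x) -/(spinact ws s) rhoNl rhoBl rhoZl rho_unitK // opprB.
rewrite -(IH uws); apply/eqP; rewrite subr_eq.
by rewrite [X in _ == X]rho_anticomm.
Qed.

Lemma spinact_revK ws : unitv ws -> cancel (spinact ws) (spinact (rev ws)).
Proof.
elim: ws => // w ws IH /unitv_cons[ww uws] s.
by rewrite rev_cons -cats1 spinact_cat /= rho_unitK // IH.
Qed.

Lemma spinact_rev ws : unitv ws -> cancel (spinact (rev ws)) (spinact ws).
Proof.
move=> uws s; rewrite -{1}[ws]revK spinact_revK // => x.
by rewrite mem_rev => /uws.
Qed.

Lemma spinact_inj ws : unitv ws -> injective (spinact ws).
Proof. by move=> uws; apply: can_inj (spinact_revK uws). Qed.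

Lemma spinact_halfspin ws b s : ~~ odd (size ws) ->
  s \in halfspin F n b -> spinact ws s \in halfspin F n b.
Proof.
move=> ews sb; suff: spinact ws s \in halfspin F n (odd (size ws) (+) b).
  by rewrite (negPf ews).
elim: ws {ews} => //= w ws IH; rewrite addNb; exact: rho_halfspin.
Qed.

Lemma incident_spinact ws p q :
  incident p q -> incident (spinact ws p) (spinact ws q).
Proof. by elim: ws => //= w ws IH /IH; apply: incident_rho. Qed.

End Reflections.

(** * Witt's theorem for isotropic families *)

Section Witt.

Variables (F : numClosedFieldType) (n : nat).
Implicit Types (w x y z v : V F n) (ws ms ls : seq (V F n)).

Lemma refl_swap y z : form y y = 0 -> form z z = 0 -> form y z != 0 ->
  exists w, [/\ form w w = 1, refl w y = z
    & forall m, form m y = 0 -> form m z = 0 -> refl w m = m].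
Proof.
(* Since y and z are isotropic, <y - z, y - z> = -2<y, z>; this r makes r (y - z) a unit vector. *)
move=> yy zz yz; pose r := (sqrtC (- (form y z *+ 2)))^-1.
have rr : r * r * (form y z *+ 2) = -1.
  rewrite -expr2 exprVn sqrtCK invrN mulNr mulVf ?mulrn_eq0 //.
exists (r *: (y - z)); split=> [||m my mz].
- by rewrite !formE yy zz (formC z) -[1]opprK -rr; ring.
- rewrite /refl !formE yy scalerA (formC z).
  by rewrite [X in X *: _](_ : _ = 1) ?scale1r ?subKr // -[1]opprK -rr; ring.
- by apply: refl_fix; rewrite !formE !(formC _ m) my mz subrr mulr0.
Qed.

(** Nondegeneracy of the form; the doubled coefficients offset the factor 1/2 in [form]. *)
Lemma form_functional (f : {scalar V F n}) : exists v, forall x, form v x = f x.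
Proof.
exists (Vof (fun a => (f (vec F (dual a)) : F) *+ 2)) => x.
rewrite form_sum [in RHS](vec_sum x) linear_sum mulr_sumr.
rewrite [RHS](reindex_inj (can_inj (@dualK n))) /=; apply: eq_bigr => a _.
by rewrite VofE linearZ /= mulr2n; field.
Qed.

(** The vector v represents the coordinate functional of y in the free family. *)
Lemma form_separate y ms : free (y :: ms) ->
  exists2 v, {in ms, forall m, form v m = 0} & form v y = 1.
Proof.
move=> yms; pose X := in_tuple (y :: ms).
have [v vE] := form_functional (coord X ord0).
exists v => [m mms|]; rewrite vE; last exact: (coord_free ord0 ord0).
have im : ((index m ms).+1 < size (y :: ms))%N by rewrite ltnS index_mem.
have := coord_free (X := X) (Ordinal im) ord0 yms.
by rewrite /= nth_index.
Qed.

(** The orthogonal complement of [ms] is not the union of two proper subspaces: if neither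
    separating vector works for both y and z, their sum does. *)
Lemma form_separate2 y z ms : free (y :: ms) -> free (z :: ms) ->
  exists v, [/\ {in ms, forall m, form v m = 0}, form v y != 0 & form v z != 0].
Proof.
move=> /form_separate[v1 v1m v1y] /form_separate[v2 v2m v2z].
have [v1z|] := eqVneq (form v1 z) 0; last first.
  by move=> v1z; exists v1; rewrite v1y oner_eq0; split.
have [v2y|] := eqVneq (form v2 y) 0; last first.
  by move=> v2y; exists v2; rewrite v2z oner_eq0; split.
exists (v1 + v2); rewrite !formE v1y v1z v2y v2z addr0 add0r !oner_eq0; split=> // m mm.
by rewrite formDl v1m ?v2m ?addr0.
Qed.

(** If <y, z> is nonzero, one reflection suffices. Otherwise two reflections pass through an
    isotropic vector t orthogonal to [ms] but to neither y nor z. *)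
Lemma refls_swap y z ms : form y y = 0 -> form z z = 0 ->
    {in ms, forall m, form m y = 0} -> {in ms, forall m, form m z = 0} ->
    free (y :: ms) -> free (z :: ms) ->
  exists ws, [/\ unitv ws, refls ws y = z & {in ms, forall m, refls ws m = m}].
Proof.
move=> yy zz ymN zmN fy fz; have [yz|yz] := eqVneq (form y z) 0; last first.
  have [w [ww wyz wm]] := refl_swap yy zz yz.
  exists [:: w]; split=> // [x|m mm]; first by rewrite inE => /eqP->.
  by rewrite /= wm ?ymN ?zmN.
have [v [vm vy vz]] := form_separate2 fy fz.
(* Adding this multiple of y makes v isotropic and preserves its pairings with y, z and [ms]. *)
pose r := - form v v / (form v y *+ 2); pose t := v + r *: y.
have tt : form t t = 0.
  by rewrite !formE yy (formC y v) /r; field.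
have yt : form y t != 0 by rewrite !formE yy mulr0 addr0 formC.
have tz : form t z != 0 by rewrite !formE yz mulr0 addr0.
have tm : {in ms, forall m, form m t = 0}.
  by move=> m mm; rewrite !formE formC vm // ymN // mulr0 addr0.
have [w [ww wyt wm]] := refl_swap yy tt yt.
have [w' [ww' wtz wm']] := refl_swap tt zz tz.
exists [:: w'; w]; split=> [x||m mm].
- by rewrite !inE => /orP[/eqP->|/eqP->].
- by rewrite /= wyt wtz.
- by rewrite /= wm ?ymN ?tm // wm' ?zmN ?tm.
Qed.

(** By induction the tail is carried to the target tail; [refls_swap] then corrects the head while
    fixing the target tail pointwise. *)
Lemma witt ls ms : size ls = size ms -> free ls -> free ms ->
    {in ls &, forall x y, form x y = 0} -> {in ms &, forall x y, form x y = 0} ->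
  exists2 ws, unitv ws & map (refls ws) ls = ms.
Proof.
elim: ls ms => [|l ls IH] [|m ms] //=; first by exists [::].
case=> szE fl fm il im.
have [fl1 fm1] : free ls /\ free ms.
  by move: fl fm; rewrite !free_cons => /andP[_ ->] /andP[_ ->].
have sub (T : eqType) (a : T) (s : seq T) : {subset s <= a :: s}.
  by move=> x xs; rewrite inE xs orbT.
have [||ws uws wsE] := IH ms szE fl1 fm1 _ _.
- by move=> x y xl yl; apply: il; apply: sub.
- by move=> x y xl yl; apply: im; apply: sub.
have ll : form l l = 0 by apply: il; rewrite inE eqxx.
have mm : form m m = 0 by apply: im; rewrite inE eqxx.
have fy : free (refls ws l :: ms).
  move: fl; rewrite !free_cons fm1 andbT => /andP[+ _]; apply: contra.
  rewrite -wsE -(eq_map (lfunE (refls ws))) -limg_span.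
  by move=> /memv_imgP[x xl]; rewrite lfunE => /(refls_inj uws)->.
have [|||ws' [uws' ws'l ws'm]] := refls_swap _ mm _ _ fy fm.
- by rewrite form_refls.
- move=> x0; rewrite -wsE => /mapP[x xl ->]; rewrite form_refls //.
  by apply: il; rewrite inE ?eqxx ?xl ?orbT.
- by move=> x xm; apply: im; rewrite inE ?eqxx ?xm ?orbT.
exists (ws' ++ ws); first exact: unitv_cat.
rewrite refls_cat ws'l; congr (_ :: _); rewrite -[RHS]map_id.
rewrite (eq_map (refls_cat ws' ws)) (map_comp (refls ws')) wsE.
exact/eq_in_map.
Qed.

End Witt.

(** Independence is detected by functionals whose matrix on the family is diagonal with nonzero
    diagonal. *)
Lemma free_map_dual (F : fieldType) (vT : vectType F) (I : eqType) (ks : seq I)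
    (f : I -> vT) (lam : I -> vT -> F) :
    (forall k, scalar (lam k)) -> uniq ks ->
    {in ks &, forall k j, j != k -> lam k (f j) = 0} ->
    {in ks, forall k, lam k (f k) != 0} ->
  free (map f ks).
Proof.
move=> lin_lam; elim: ks => [|k ks IH] /=; first by rewrite nil_free.
case/andP=> kks uks lam0 lamN0; rewrite free_cons IH ?andbT //.
- apply: contra (lamN0 k _); last by rewrite inE eqxx.
  move=> fk; apply/eqP; apply: (span_scalar_eq0 (lin_lam k)) fk => _ /mapP[j jks ->].
  by apply: lam0; rewrite ?inE ?eqxx ?jks ?orbT //; apply: contraNneq kks => <-.
- by move=> i j iks jks; apply: lam0; rewrite inE ?iks ?jks orbT.
- by move=> i iks; apply: lamN0; rewrite inE iks orbT.
Qed.

Lemma mx_coord_scalar (F : fieldType) (d : nat) (k : 'I_d) :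
  scalar (fun x : 'rV[F]_d => x 0 k).
Proof. by move=> r x y; rewrite !mxE. Qed.

(** * Scaling in wedge products and induced maps on basis vectors *)

Section Wedges.

Variables (F : fieldType) (d : nat).
Implicit Types (s : ext F d) (u : 'rV[F]_d).

Lemma wedgeZl (r : F) u s : wedge (r *: u) s = r *: wedge u s.
Proof.
apply/ffunP=> K; rewrite !ffunE scaler_sumr; apply: eq_bigr => j _.
by rewrite mxE /GRing.scale /=; ring.
Qed.

Lemma wedgeZr (r : F) u s : wedge u (r *: s) = r *: wedge u s.
Proof.
apply/ffunP=> K; rewrite !ffunE scaler_sumr; apply: eq_bigr => j _.
by rewrite ffunE /GRing.scale /=; ring.
Qed.

Lemma wedges_scale (c : 'I_d -> F) (f : 'I_d -> 'rV[F]_d) (ks : seq 'I_d) :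
  wedges [seq c k *: f k | k <- ks] = (\prod_(k <- ks) c k) *: wedges [seq f k | k <- ks].
Proof.
elim: ks => [|k ks IH] /=; first by rewrite big_nil scale1r.
by rewrite big_cons -/(wedges _) IH wedgeZl wedgeZr scalerA.
Qed.

Lemma extmap_vb (A : 'rV[F]_d -> 'rV[F]_d) (K : {set 'I_d}) :
  extmap A (vb F K) = wedges [seq A (eb F k) | k <- enum K].
Proof.
rewrite /extmap (bigD1 K) //= ffunE eqxx scale1r big1 ?addr0 // => J JK.
by rewrite ffunE (negPf JK) scale0r.
Qed.

End Wedges.

(** * The base point of the orbit and transitivity of Spin *)

Section BasePoint.

Variables (F : numClosedFieldType) (n : nat) (i0 : 'I_n).
Implicit Types (s p q : ext F n) (L : {vspace V F n}).

(* The isotropic subspace spanned by the e_i^* with i != i0; it annihilates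
   the spinors 1 and e_i0. *)
Definition baseset : {set 'I_(n + n)} := [set Vindex (false, i) | i in [set~ i0]].
Definition base : seq (V F n) := [seq eb F k | k <- enum baseset].

Lemma card_baseset : #|baseset| = n.-1.
Proof.
rewrite card_imset ?cardsC1 ?card_ord // => i j /Vindex_inj[].
by [].
Qed.

Lemma basesetP k : reflect (exists2 i, i != i0 & k = Vindex (false, i)) (k \in baseset).
Proof.
apply: (iffP imsetP) => -[i ]; first by rewrite !inE => ii0 ->; exists i.
by move=> ii0 ->; exists i; rewrite ?inE.
Qed.

Lemma baseP x : x \in base -> exists2 i, i != i0 & x = vec F (false, i).
Proof. by case/mapP=> k; rewrite mem_enum => /basesetP[i ii0 ->] ->; exists i. Qed.

Lemma free_base : free base.
Proof.
apply: (@free_map_dual F (V F n) _ _ _ (fun k x => x 0 k)) => [k||k j _ _ jk|k _].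
- exact: mx_coord_scalar.
- exact: enum_uniq.
- by rewrite mxE eq_sym (negPf jk) andbF.
- by rewrite mxE !eqxx oner_eq0.
Qed.

Lemma spin_of_IG L : IG L -> exists ws,
  [/\ ~~ odd (size ws), unitv ws & map (conjs ws) base = vbasis L].
Proof.
case=> dimL isoL.
have [|||||ws uws wsE] := @witt F n base (vbasis L).
- by rewrite size_map -cardE card_baseset size_tuple.
- exact: free_base.
- exact: basis_free (vbasisP L).
- by move=> _ _ /baseP[i _ ->] /baseP[j _ ->]; rewrite form_vec mulr0.
- by move=> x y /vbasis_mem xL /vbasis_mem yL; apply: isoL.
have [ows|ews] := boolP (odd (size ws)); last first.
  exists ws; split=> //; rewrite -wsE; apply: eq_map => x.
  by rewrite conjsE -signr_odd (negPf ews) scale1r.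
(* This unit vector is orthogonal to every e_i^* with i != i0, so its reflection fixes the base
   family and only corrects the parity of the product. *)
pose u := vec F (true, i0) + vec F (false, i0).
exists (rcons ws u); split.
- by rewrite size_rcons /= negbK.
- rewrite -cats1; apply: unitv_cat => // x; rewrite inE => /eqP->.
  by rewrite !formE !form_vec /= eqxx /=; field.
rewrite -wsE; apply/eq_in_map => _ /baseP[i ii0 ->].
rewrite conjsE size_rcons -signr_odd /= ows scale1r -cats1 refls_cat; congr (refls _ _).
by apply: refl_fix; rewrite !formE !form_vec /= eq_sym (negPf ii0) !mulr0 addr0.
Qed.

Definition basespinor (b : bool) : ext F n :=
  vb F (if b then [set i0] else finset.set0).

Lemma basespinor_halfspin b : basespinor b \in halfspin F n b.
Proof.
apply/halfspinP=> J Jb; rewrite ffunE; case: eqP => // JE; move: Jb.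
by rewrite JE; case: b {JE}; rewrite ?cards1 ?cards0.
Qed.

Lemma basespinor_neq0 b : basespinor b != 0.
Proof.
apply/eqP=> /ffunP/(_ (if b then [set i0] else finset.set0)) /eqP.
by rewrite !ffunE eqxx oner_eq0.
Qed.

(** Pulled back to the base point, p is killed by every e_i^* with i != i0, so only its coordinates
    at the empty set and at {i0} can be nonzero; parity keeps one of them. *)
Lemma annihilated_line L ws b p : ~~ odd (size ws) -> unitv ws ->
    map (conjs ws) base = vbasis L -> p \in halfspin F n b ->
    {in L, forall x, rho x p = 0} ->
  p \in <[spinact ws (basespinor b)]>%VS.
Proof.
move=> ews uws wsE pb Lp; pose s := spinact (rev ws) p.
have sb : s \in halfspin F n b by apply: spinact_halfspin; rewrite ?size_rev.
have s0 i (K : {set 'I_n}) : i != i0 -> i \in K -> s K = 0.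
  move=> ii0 iK; have: cliff (false, i) s = 0.
    apply: (spinact_inj uws); rewrite linear0 -rho_vec -spin_vector_conjs //.
    rewrite /s spinact_rev //; apply: Lp; apply: vbasis_mem.
    rewrite -[_ \in _]/(_ \in tval (vbasis L)) -wsE.
    by apply/map_f/map_f; rewrite mem_enum; apply/basesetP; exists i.
  move/ffunP/(_ (flip i K)); rewrite !ffunE /= in_flip iK eqxx flipK.
  by move/eqP; rewrite mulf_eq0 (negPf (sgn_neq0 _ _ _)) => /eqP.
suff sE : s = (s (if b then [set i0] else finset.set0) : F) *: basespinor b.
  by rewrite -[p](spinact_rev uws) -/s sE linearZ /= memvZ ?memv_line.
apply/ffunP=> K; rewrite !ffunE; case: eqP => [->|KN].
  by rewrite /GRing.scale /= mulr1.
rewrite scaler0; have [/set0Pn[i ]|] := boolP (K :\ i0 != finset.set0).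
  by rewrite !inE => /andP[]; apply: s0.
rewrite negbK setD_eq0 subset1 => Ki0.
apply: (halfspinP _ _ sb); apply/eqP=> Kb; apply: KN; move: Kb.
by case/orP: Ki0 => /eqP->; rewrite ?cards1 ?cards0 => <-.
Qed.

End BasePoint.

(** * Lines in vector spaces *)

Section Lines.

Variables (F : fieldType) (vT : vectType F).

Lemma vline_scale (r : F) (v : vT) : r != 0 -> <[r *: v]>%VS = <[v]>%VS.
Proof.
move=> r0; apply/vspaceP=> w; apply/vlineP/vlineP=> -[t ->].
  by exists (t * r); rewrite scalerA.
by exists (t / r); rewrite scalerA divfK.
Qed.

Lemma vline_mem (v w : vT) : v != 0 -> v \in <[w]>%VS -> <[v]>%VS = <[w]>%VS.
Proof.
move=> v0 /vlineP[r vE]; rewrite vE vline_scale //.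
by apply: contraNneq v0 => r0; rewrite vE r0 scale0r.
Qed.

Lemma dim1_line (U : {vspace vT}) (v : vT) :
  \dim U = 1%N -> v \in U -> v != 0 -> U = <[v]>%VS.
Proof.
move=> dU vU v0; apply/esym/eqP; rewrite eqEdim -memvE vU dU dim_vline v0.
by [].
Qed.

Lemma dim1P (U : {vspace vT}) : \dim U = 1%N -> exists2 v, v != 0 & U = <[v]>%VS.
Proof.
move=> dU; have v0 : vpick U != 0 by rewrite vpick0 -dimv_eq0 dU.
by exists (vpick U) => //; apply: dim1_line => //; apply: memv_pick.
Qed.

End Lines.

(** * Rank-one tensors and the Segre map *)

Section Segre.

Variables (F : fieldType) (n : nat).
Implicit Types (p q : ext F n) (P Q : {vspace ext F n}).

Lemma ext_neq0 p : p != 0 -> exists K, p K != 0.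
Proof.
move=> pN0; apply/existsP; apply: contraNT pN0; rewrite negb_exists => /forallP p0.
by apply/eqP/ffunP=> K; rewrite ffunE; apply/eqP; rewrite -[_ == _]negbK p0.
Qed.

Lemma tensmap_diag (g : ext F n -> ext F n) (c : {set 'I_n} -> F) (T : ext2 F n) J K :
    (forall I, g (vb F I) = c I *: vb F I) ->
  tensmap g g T (J, K) = c J * c K * T (J, K).
Proof.
move=> gE; pose T' : ext2 F n := [ffun IM => c IM.1 * c IM.2 * T IM].
have -> : tensmap g g T = T'; last by rewrite ffunE.
rewrite [RHS]tens_vb_sum; apply: eq_bigr => I _; apply: eq_bigr => M _.
by rewrite ffunE !gE tensZl tensZr !scalerA; congr (_ *: _) => /=; ring.
Qed.

Lemma mem_tensv P Q p q : p \in P -> q \in Q -> tens p q \in tensv P Q.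
Proof.
move=> pP qQ; rewrite (coord_vbasis pP) (coord_vbasis qQ) tens_suml.
apply: memv_suml => i _; rewrite tens_sumr; apply: memv_suml => j _.
rewrite tensZl tensZr; do 2!apply: memvZ; apply: memv_span.
by apply/allpairsP; exists ((vbasis P)`_i, (vbasis Q)`_j); rewrite /= !mem_nth ?size_tuple.
Qed.

Lemma tensv_line p q : tensv <[p]> <[q]> = <[tens p q]>%VS.
Proof.
apply/eqP; rewrite eqEsubv -memvE mem_tensv ?memv_line // andbT.
apply/span_subvP=> w /allpairsP[[p' q'] /= [pP qQ ->]].
have /vlineP[r ->] := vbasis_mem pP; have /vlineP[t ->] := vbasis_mem qQ.
rewrite tensZl tensZr scalerA.
by rewrite memvZ ?memv_line.
Qed.

Lemma tensv_halfspin b c (T : ext2 F n) (J K : {set 'I_n}) :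
    T \in tensv (halfspin F n b) (halfspin F n c) ->
  (odd #|J| != b) || (odd #|K| != c) -> T (J, K) = 0.
Proof.
move=> TS JK; apply: (span_scalar_eq0 (@ffun_coord_scalar F _ (J, K))) TS => T'.
case/allpairsP=> -[p q] /= [pP qQ ->].
have /halfspinP pb := vbasis_mem pP; have /halfspinP qc := vbasis_mem qQ.
by rewrite ffunE /=; case/orP: JK => [/pb->|/qc->]; rewrite ?mul0r ?mulr0.
Qed.

Lemma tens_eq_line p q p' q' (r : F) : p != 0 -> q != 0 ->
  tens p q = r *: tens p' q' -> p \in <[p']>%VS /\ q \in <[q']>%VS.
Proof.
move=> /ext_neq0[J pJ] /ext_neq0[K qK] E.
split; apply/vlineP.
  exists (r * q' K / q K); apply/ffunP=> I; have /ffunP/(_ (I, K)) := E.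
  rewrite !ffunE /GRing.scale /= => EI; apply: (mulIf qK); rewrite EI; field.
  exact: qK.
exists (r * p' J / p J); apply/ffunP=> I; have /ffunP/(_ (J, I)) := E.
rewrite !ffunE /GRing.scale /= => EI; apply: (mulfI pJ); rewrite EI; field.
exact: pJ.
Qed.

End Segre.

(** * The equivariant inclusion at the base point *)

Section Embedding.

Variables (F : numClosedFieldType) (n : nat) (i0 : 'I_n).
Variable phi : 'Hom(ext F (n + n), ext2 F n).
Hypothesis hphi : equivariant_inclusion phi.
Implicit Types (s p q : ext F n) (L : {vspace V F n}).

Definition torusv (i : 'I_n) (r : F) : V F n :=
  r *: vec F (true, i) + r^-1 *: vec F (false, i).

Lemma torusv_unit i r : r != 0 -> form (torusv i r) (torusv i r) = 1.
Proof. by move=> r0; rewrite !formE !form_vec /= eqxx /=; field. Qed.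

(** An element of the diagonal torus of Spin: v_J has weight 2 or 1/2 according to whether i lies in
    J, and e_i^* is scaled by 1/4. *)
Definition torus (i : 'I_n) : seq (V F n) := [:: torusv i 2%:R; torusv i 1].

Lemma torus_spinact i s K :
  spinact (torus i) s K = (if i \in K then 2%:R else 2%:R^-1) * s K.
Proof.
have E r t J : rho (torusv i r) t J =
    (if i \in J then r else r^-1) * (sgn F i J * t (flip i J)).
  rewrite rhoDl !rhoZl !rho_vec !ffunE /=.
  by case: (i \in J); rewrite ?scaler0 ?addr0 ?add0r.
rewrite /= !E flipK sgn_flip_id invr1 if_same mul1r [sgn _ _ _ * _]mulrA sgn_sqr mul1r.
by [].
Qed.

Lemma torus_vb i J :
  spinact (torus i) (vb F J) = (if i \in J then 2%:R else 2%:R^-1) *: vb F J.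
Proof.
apply/ffunP=> K; rewrite torus_spinact !ffunE.
by have [->|_] := eqVneq K J; rewrite ?mulr0 ?scaler0.
Qed.

Lemma torus_conjs i j : conjs (torus i) (vec F (false, j)) =
  (if j == i then 4%:R^-1 else 1) *: vec F (false, j).
Proof.
rewrite conjsE sqrrN expr1n scale1r /=; case: eqP => [->|/eqP ji]; last first.
  rewrite scale1r !refl_fix // !formE !form_vec /= eq_sym (negPf ji) ?mulr0 ?addr0 //.
rewrite /refl /torusv !formE !form_vec /= eqxx /=.
by apply/rowP=> k; rewrite !mxE; field.
Qed.

Lemma vb_baseset_extpow : vb F (baseset i0) \in extpow F (n + n) n.-1.
Proof.
by apply/memv_span/map_f; rewrite mem_filter mem_enum card_baseset eqxx.
Qed.

(** For i != i0 the torus element at i scales the wedge of the base family by 1/4, whereas it scales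
    the coordinate (J, K) by 4, 1 or 1/4 as two, one or none of J and K contain i. Hence J and K lie
    in {i0}, and parity leaves the empty set and {i0}. Injectivity makes the scalar nonzero. *)
Lemma phi_baseset : exists2 r : F, r != 0 &
  phi (vb F (baseset i0)) = r *: tens (basespinor F i0 false) (basespinor F i0 true).
Proof.
have [phiS phi_inj phi_eq] := hphi; have wU := vb_baseset_extpow.
set T := phi _; have TS : T \in tensv (Splus F n) (Sminus F n).
  by apply: subvP phiS _ (memv_img _ wU).
(* Equivariance under the identity, the empty product, spares the comparison of the iterated wedge
   with the basis vector. *)
have TE : phi (wedges (base F i0)) = T.
  have := phi_eq id id; rewrite /base -(extmap_vb id) => -> //.
    by rewrite tensmap_id.
  by exists [::].
have T0 i (J K : {set 'I_n}) : i != i0 -> (i \in J) || (i \in K) -> T (J, K) = 0.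
  move=> ii0 iJK; have ut : unitv (torus i).
    by move=> x; rewrite !inE => /orP[]/eqP->; apply: torusv_unit;
      rewrite ?oner_eq0 ?pnatr_eq0.
  have := phi_eq _ _ (spin_spinact (ws := torus i) isT ut) (spin_vector_conjs ut) _ wU.
  rewrite extmap_vb.
  have -> : [seq conjs (torus i) (eb F k) | k <- enum (baseset i0)] =
      [seq (if k == Vindex (false, i) then 4%:R^-1 else 1) *: eb F k
         | k <- enum (baseset i0)].
    apply/eq_in_map => k; rewrite mem_enum => /basesetP[j _ ->].
    by rewrite torus_conjs (inj_eq (@Vindex_inj n)).
  rewrite wedges_scale (bigD1_seq (Vindex (false, i))) ?enum_uniq //=; last first.
    by rewrite mem_enum; apply/basesetP; exists i.
  rewrite eqxx big1 => [|k /negPf->//]; rewrite mulr1 linearZ /= TE -/T.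
  move/ffunP/(_ (J, K)); rewrite (tensmap_diag _ _ _ (torus_vb i)) ffunE.
  rewrite /GRing.scale /= => /eqP; rewrite -subr_eq0 -mulrBl mulf_eq0.
  case/orP=> [|/eqP//]; move: iJK; case: (i \in J); case: (i \in K) => //= _.
  (* The weight differences are 1/4 - 4 here and 1/4 - 1 in the two mixed cases. *)
  - rewrite (_ : _ - _ = - (15%:R / 4%:R)); last by field.
    by rewrite oppr_eq0 mulf_eq0 invr_eq0 !pnatr_eq0.
  - rewrite (_ : _ - _ = - (3%:R / 4%:R)); last by field.
    by rewrite oppr_eq0 mulf_eq0 invr_eq0 !pnatr_eq0.
  - rewrite (_ : _ - _ = - (3%:R / 4%:R)); last by field.
    by rewrite oppr_eq0 mulf_eq0 invr_eq0 !pnatr_eq0.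
have TE' : T = (T (finset.set0, [set i0]) : F) *:
    tens (basespinor F i0 false) (basespinor F i0 true).
  apply/ffunP=> -[J K]; rewrite !ffunE /= -natrM mulnb.
  have sub0 (A : {set 'I_n}) : (exists2 i, i != i0 & i \in A) \/
      (A = finset.set0 \/ A = [set i0]).
    have [/set0Pn[i ]|] := boolP (A :\ i0 != finset.set0).
      by rewrite !inE => /andP[? ?]; left; exists i.
    by rewrite negbK setD_eq0 subset1 orbC => /orP[]/eqP->; right; [left | right].
  have [[i ii0 iJ]|J0] := sub0 J.
    rewrite (T0 i) ?iJ // (_ : J == finset.set0 = false) ?scaler0 //.
    by apply/eqP=> J0; rewrite J0 inE in iJ.
  have [[i ii0 iK]|K0] := sub0 K.
    rewrite (T0 i) ?iK ?orbT // (_ : K == [set i0] = false) ?andbF ?scaler0 //.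
    by apply/eqP=> K0; rewrite K0 inE (negPf ii0) in iK.
  have [/andP[/eqP-> /eqP->]|JK] := boolP ((J == _) && _).
    by rewrite /GRing.scale /= mulr1.
  rewrite scaler0; apply: (tensv_halfspin TS); apply: contraR JK.
  rewrite negb_or !negbK => /andP[/eqP oJ /eqP oK].
  by case: J0 oJ => ->; case: K0 oK => ->; rewrite ?cards0 ?cards1 ?eqxx.
exists (T (finset.set0, [set i0])) => //; apply/eqP=> r0.
have /ffunP/(_ (baseset i0)) : vb F (baseset i0) = 0.
  by apply: phi_inj; rewrite ?mem0v // -/T TE' r0 scale0r linear0.
by rewrite !ffunE eqxx => /eqP; rewrite oner_eq0.
Qed.

Lemma IG_embedding_line L : IG L -> exists ws,
  [/\ ~~ odd (size ws), unitv ws, map (conjs ws) (base F i0) = vbasis L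
    & IG_embedding phi L =
      <[tens (spinact ws (basespinor F i0 false)) (spinact ws (basespinor F i0 true))]>%VS].
Proof.
move=> /(spin_of_IG i0)[ws [ews uws wsE]]; exists ws; split=> //.
have [_ _ phi_eq] := hphi; have [r r0 phiE] := phi_baseset.
have := phi_eq _ _ (spin_spinact ews uws) (spin_vector_conjs uws) _ vb_baseset_extpow.
rewrite phiE extmap_vb (map_comp (conjs ws)) -/(base F i0) wsE => phiL.
rewrite /IG_embedding /plucker limg_line phiL linearZ /=.
by rewrite tensmap_tens vline_scale.
Qed.

End Embedding.

(** * The isotropic subspace of an incident pair *)

Section IncidentPairs.

Variables (F : numFieldType) (n : nat).
Implicit Types (s p q : ext F n) (J K : {set 'I_n}).

(** The vector obtained from Omega by evaluating its second factor on p at the coordinate K; acting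
    on a first spinor, it gives the slice of [omega] at K. *)
Definition slice p K : V F n := Vof (fun a => cliff (dual a) p K : F).

Lemma incident_slice p q K : incident p q -> rho (slice q K) p = (p K : F) *: q.
Proof.
move=> pq; rewrite rho_Vof; apply/ffunP=> J; rewrite sum_ffunE.
transitivity (omega p q (J, K)); last by rewrite pq !ffunE /GRing.scale /= mulrC.
rewrite sum_ffunE; apply: eq_bigr => a _.
by rewrite [LHS]ffunE [RHS]ffunE /GRing.scale /= mulrC.
Qed.

(** Twice the pairing is a coordinate of [omega p p] at two sets that differ at most in k and l. For
    k != l its two terms both contain p_J times the coordinate at J flipped at k and l, with
    opposite signs. *)
Lemma form_slice p J (k l : 'I_n) :
  form (slice p (flip k J)) (slice p (flip l J)) = 0.
Proof.
have two0 : 2%:R != 0 :> F by rewrite pnatr_eq0.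
apply: (mulfI two0); rewrite mulr0 mulr_natl form_coord.
have -> : \sum_a slice p (flip k J) 0 (Vindex a) * slice p (flip l J) 0 (Vindex (dual a))
    = omega p p (flip l J, flip k J).
  rewrite sum_ffunE; apply: eq_bigr => a _.
  by rewrite !VofE dualK [in RHS]ffunE /= mulrC.
rewrite omega_coord; have [->|kl] := eqVneq k l.
  by rewrite big_pred0 // => j; rewrite eqxx.
rewrite (bigD1 k) /=; last by rewrite !in_flip eqxx (negPf kl); case: (_ \in _).
rewrite (bigD1 l) /=; last first.
  by rewrite !in_flip eqxx (eq_sym l) (negPf kl); case: (_ \in _).
rewrite big1 => [|j /andP[/andP[]]]; last first.
  by rewrite !in_flip => + /negPf jk /negPf jl; rewrite jk jl eqxx.
rewrite !flipK !sgn_flip !ltnn (flipC l k) expr0 !mul1r addr0.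
have -> : (k < l)%N = ~~ (l < k)%N.
  by rewrite -leqNgt [in RHS]leq_eqVlt val_eqE (negPf kl).
have := sgn_sqr F k J; have := sgn_sqr F l J.
move: (sgn F k J) (sgn F l J) => sk sl El Ek.
case: (l < k)%N; rewrite /= ?expr0 ?expr1 ?mul1r ?mulN1r ?mulNr ?mulrN El Ek; ring.
Qed.

Lemma slice_flip p J (k j : 'I_n) : slice p (flip j J) 0 (Vindex (k \in J, k)) =
  if j == k then sgn F k J * p J else 0.
Proof.
rewrite VofE ffunE /= in_flip (eq_sym k j).
have [->|_] := eqVneq j k; last by case: (_ \in _).
by rewrite addbT eqxx flipK sgn_flip_id.
Qed.

(** With p_J nonzero, the slices z_k of p satisfy z_k q = q_(J flipped at k) p, so the combinations
    f_k of z_k and z_m kill q. They also kill p, a multiple of z_m q, because f_k is orthogonal to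
    z_m. The coordinates of [slice_flip] show that the n - 1 vectors f_k with k != m are
    independent. *)
Lemma incident_IG p q : p != 0 -> q != 0 -> incident p q ->
  exists2 L, IG L & {in L, forall x, rho x p = 0 /\ rho x q = 0}.
Proof.
move=> p0 q0 pq; have [J pJ] := ext_neq0 p0.
(* Otherwise [slice q J] is zero, and the incidence equation gives p_J q = 0. *)
have [m qm] : exists m, q (flip m J) != 0.
  apply/existsP; apply: contraNT q0; rewrite negb_exists => /forallP qN0.
  have sl0 : slice q J = 0.
    rewrite /slice /Vof big1 // => a _; rewrite ffunE /=.
    have /negbNE/eqP-> := qN0 a.2; by rewrite mulr0 if_same scale0r.
  have := incident_slice J pq; rewrite sl0 -(scale0r 0) rhoZl scale0r => /esym/eqP.
  by rewrite scaler_eq0 (negPf pJ).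
pose z k := slice p (flip k J).
have zq k : rho (z k) q = (q (flip k J) : F) *: p by apply/incident_slice/incidentC.
pose f k := (q (flip m J) : F) *: z k - (q (flip k J) : F) *: z m.
have fq k : rho (f k) q = 0.
  by rewrite rhoBl !rhoZl !zq !scalerA mulrC subrr.
have fp k : rho (f k) p = 0.
  apply: (scalerI qm); rewrite scaler0 -rhoZr -zq.
  have /eqP := rho_anticomm (f k) (z m) q.
  rewrite fq linear0 addr0 => /eqP->.
  by rewrite !formE !form_slice !mulr0 subrr mul0rn scale0r.
pose ks := enum [set~ m].
have ff : free (map f ks).
  apply: (@free_map_dual F (V F n) _ _ _ (fun k x => x 0 (Vindex (k \in J, k)))).
  - by move=> k; apply: mx_coord_scalar.
  - exact: enum_uniq.
  - move=> k j; rewrite !mem_enum !inE => km _ jk; rewrite 4!mxE !slice_flip.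
    by rewrite (negPf jk) (eq_sym m) (negPf km) !mulr0 subrr.
  - move=> k; rewrite !mem_enum !inE => km; rewrite 4!mxE !slice_flip eqxx.
    by rewrite (eq_sym m) (negPf km) mulr0 subr0 !mulf_neq0 ?sgn_neq0.
have kill s : (forall k, rho (f k) s = 0) -> {in <<map f ks>>%VS, forall x, rho x s = 0}.
  move=> fs x xL; apply/ffunP=> K; rewrite [RHS]ffunE.
  apply: (@span_scalar_eq0 _ _ _ (fun x => rho x s K)) xL.
    by move=> r y y'; rewrite rhoDl rhoZl !ffunE.
  by move=> y /mapP[k _ ->]; rewrite fs ffunE.
exists <<map f ks>>%VS; last by move=> x xL; rewrite !kill.
split; first by rewrite (eqnP ff) size_map -cardE cardsC1 card_ord.
(* Vectors killing the nonzero spinor p are orthogonal: 2<x, y> p = 0. *)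
move=> x y xL yL; have /eqP := rho_anticomm x y p.
rewrite (kill p fp x) // (kill p fp y) // !linear0 addr0 eq_sym scaler_eq0 (negPf p0) orbF.
by rewrite mulrn_eq0 => /eqP.
Qed.

End IncidentPairs.

(** * Incident pairs of lines form a Zariski-closed set *)

Section IncidenceVariety.

Variables (F : numFieldType) (n : nat).
Implicit Types (s p q : ext F n) (J K : {set 'I_n}).
Implicit Types (PQ : {vspace ext F n} * {vspace ext F n}).

Definition coordvar J : coordpoly F n := 'X_(enum_rank J).

Definition incidence_poly J K : coordpoly F n :=
  \sum_(j | (j \in J) != (j \in K))
    (sgn F j J * sgn F j K) *: (coordvar (flip j J) * coordvar (flip j K))
  - coordvar K * coordvar J.

Lemma meval_coordvar s J : (coordvar J).@[fun i => s (enum_val i)] = s J.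
Proof. by rewrite mevalXU enum_rankK. Qed.

Lemma meval_incidence_poly p q J K :
    p \in halfspin F n false -> q \in halfspin F n true -> odd #|J| -> ~~ odd #|K| ->
  (incidence_poly J K).@[fun i => (p + q) (enum_val i)] =
  omega p q (J, K) - tens q p (J, K).
Proof.
move=> /halfspinP pS /halfspinP qS oJ oK.
have evp (I : {set 'I_n}) : ~~ odd #|I| -> (p + q) I = p I.
  by move=> oI; rewrite ffunE (qS I) ?addr0 //; case: (odd _) oI.
have evq (I : {set 'I_n}) : odd #|I| -> (p + q) I = q I.
  by move=> oI; rewrite ffunE (pS I) ?add0r //; case: (odd _) oI.
rewrite mevalB mevalM !meval_coordvar raddf_sum /= omega_coord [tens q p _]ffunE /=.
rewrite (evp K) // (evq J) // mulrC; congr (_ - _); apply: eq_bigr => j _.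
by rewrite mevalZ mevalM !meval_coordvar evp ?evq ?odd_flip ?oJ.
Qed.

Lemma bihomog_coordvar J K : ~~ odd #|J| -> odd #|K| ->
  bihomog 1 1 (coordvar J * coordvar K).
Proof.
move=> oJ oK m; rewrite /coordvar -mpolyXD msuppX inE => /eqP->.
have E1 (P : pred 'I_#|{set 'I_n}|) i : (\sum_(k | P k) (i == k) = P i)%N.
  rewrite big_mkcond (bigD1 i) //= eqxx big1 => [|k ki]; last first.
    by rewrite eq_sym (negPf ki) if_same.
  by rewrite addn0; case: (P i).
have E (P : pred 'I_#|{set 'I_n}|) i j :
    (\sum_(k | P k) (U_(i) + U_(j))%MM k = P i + P j)%N.
  under eq_bigr do rewrite mnmDE !mnm1E.
  by rewrite big_split /= !E1.
by rewrite !E !enum_rankK (negPf oJ) oK.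
Qed.

Lemma bihomog_incidence_poly J K : odd #|J| -> ~~ odd #|K| ->
  bihomog 1 1 (incidence_poly J K).
Proof.
move=> oJ oK m /msuppB_le; rewrite mem_cat => /orP[/msupp_sum_le|]; last first.
  exact: bihomog_coordvar.
case/flattenP=> ms /mapP[j _ ->] /msuppZ_le; apply: bihomog_coordvar; rewrite odd_flip //.
by rewrite negbK.
Qed.

Definition incidence_variety PQ : Prop :=
  projS PQ /\ forall p q, p \in PQ.1 -> q \in PQ.2 -> incident p q.

Lemma zclosed_incidence : zclosed incidence_variety.
Proof.
exists (fun f => exists J K, [/\ odd #|J|, ~~ odd #|K| & f = incidence_poly J K]).
  by move=> _ [J [K [oJ oK ->]]]; exists 1%N, 1%N; apply: bihomog_incidence_poly.
move=> [P Q]; split=> -[PQS PQi]; split=> //.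
  move=> f [J [K [oJ oK ->]]] p q /= pP qQ.
  have [[/subvP PS _] [/subvP QS _]] := PQS.
  by rewrite meval_incidence_poly ?PS ?QS // PQi // subrr.
move=> p q /= pP qQ; have [[/subvP PS _] [/subvP QS _]] := PQS.
have /halfspinP pS := PS _ pP; have /halfspinP qS := QS _ qQ.
(* As p is even and q odd, both sides vanish unless J is odd and K even, the case covered by the
   polynomials. *)
apply/ffunP=> -[J K]; have [oJ|oJ] := boolP (odd #|J|); last first.
  rewrite omega_coord ffunE /= (qS J) ?(negPf oJ) // mul0r big1 // => j _.
  by rewrite (pS (flip j J)) ?mul0r ?mulr0 // odd_flip oJ.
have [oK|oK] := boolP (odd #|K|).
  rewrite omega_coord ffunE /= (pS K) ?oK // mulr0 big1 // => j _.
  by rewrite (qS (flip j K)) ?mulr0 // odd_flip oK.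
apply/eqP; rewrite -subr_eq0 -meval_incidence_poly ?PS ?QS //.
by apply/eqP/PQi => //; exists J, K.
Qed.

Lemma X0_incidence PQ : (0 < n)%N -> X0 PQ -> incidence_variety PQ.
Proof.
move=> n0 [x xY ->]; have [xN0 _] := xY.
have projL b (K : {set 'I_n}) : odd #|K| = b ->
    proj (halfspin F n b) <[parity_part b x]>%VS.
  move=> oK; split; first by rewrite -memvE parity_part_halfspin.
  rewrite dim_vline; case: eqP => // /ffunP/(_ K)/eqP.
  by rewrite !ffunE oK eqxx (negPf (xN0 K)).
split=> [|p q /vlineP[r ->] /vlineP[t ->]].
  by split; [apply: (projL _ finset.set0); rewrite cards0
            | apply: (projL _ [set Ordinal n0]); rewrite cards1].
exact/incidentZ/Y0_incident.
Qed.

End IncidenceVariety.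

(** * Polynomial functions of one parameter *)

Section PolynomialFunctions.

Variable F : numFieldType.
Implicit Types f g : F -> F.

Definition polyfun f := exists c : {poly F}, forall t, f t = c.[t].

Lemma polyfun_const r : polyfun (fun=> r).
Proof. by exists r%:P => t; rewrite hornerC. Qed.

Lemma polyfun_mul f g : polyfun f -> polyfun g -> polyfun (fun t => f t * g t).
Proof. by move=> [c cE] [e eE]; exists (c * e) => t; rewrite hornerM cE eE. Qed.

Lemma polyfun_exp f k : polyfun f -> polyfun (fun t => f t ^+ k).
Proof. by move=> [c cE]; exists (c ^+ k) => t; rewrite horner_exp cE. Qed.

Lemma polyfun_sum (I : Type) (r : seq I) (P : pred I) (f : I -> F -> F) :
  (forall i, polyfun (f i)) -> polyfun (fun t => \sum_(i <- r | P i) f i t).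
Proof.
move=> pf; elim: r => [|i r [c cE]].
  by exists 0 => t; rewrite big_nil horner0.
have [e eE] := pf i; exists (if P i then e + c else c) => t.
by rewrite big_cons cE; case: ifP => _; rewrite ?hornerD ?eE.
Qed.

Lemma polyfun_prod (I : Type) (r : seq I) (P : pred I) (f : I -> F -> F) :
  (forall i, polyfun (f i)) -> polyfun (fun t => \prod_(i <- r | P i) f i t).
Proof.
move=> pf; elim: r => [|i r [c cE]].
  by exists 1 => t; rewrite big_nil hornerE.
have [e eE] := pf i; exists (if P i then e * c else c) => t.
by rewrite big_cons cE; case: ifP => _; rewrite ?hornerM ?eE.
Qed.

Lemma polyfun_mul_eq0 f g t : polyfun f -> polyfun g ->
  (forall t, f t * g t = 0) -> g t != 0 -> forall t', f t' = 0.
Proof.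
move=> [c cE] [e eE] fg0 gt t'; suff: c * e = 0.
  move/eqP; rewrite mulf_eq0 => /orP[/eqP c0|/eqP e0]; first by rewrite cE c0 horner0.
  by rewrite eE e0 horner0 eqxx in gt.
(* In characteristic zero the natural numbers supply as many distinct roots as desired. *)
apply: (@roots_geq_poly_eq0 _ _ [seq i%:R | i <- iota 0 (size (c * e))]).
- by apply/allP=> _ /mapP[i _ ->]; rewrite /root hornerM -cE -eE fg0.
- by rewrite map_inj_uniq ?iota_uniq //; apply: mulrIn; rewrite oner_eq0.
- by rewrite size_map size_iota.
Qed.

Lemma polyfun_meval (k : nat) (f : {mpoly F[k]}) (v : F -> 'I_k -> F) :
  (forall i, polyfun (v^~ i)) -> polyfun (fun t => f.@[v t]).
Proof.
move=> pv; have [c cE] : polyfun (fun t =>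
    \sum_(m <- msupp f) f@_m * \prod_i v t i ^+ m i).
  apply: polyfun_sum => m; apply: polyfun_mul; first exact: polyfun_const.
  by apply: polyfun_prod => i; apply: polyfun_exp.
by exists c => t; rewrite mevalE cE.
Qed.

(** Points of a segment between unit vectors need not be unit vectors, so a product of them may
    leave Spin; incidence persists because [incident_rho] holds for every vector. *)
Definition segment (n : nat) (xy : V F n * V F n) (t : F) : V F n :=
  (1 - t) *: xy.1 + t *: xy.2.

Lemma polyfun_spinact n (xys : seq (V F n * V F n)) s K :
  polyfun (fun t => spinact [seq segment xy t | xy <- xys] s K).
Proof.
elim: xys K => [|xy xys IH] K; first exact: polyfun_const.
have [c cE] : polyfun (fun t => \sum_a segment xy t 0 (Vindex a) *
    (if (a.2 \in K) == a.1 then sgn F a.2 K *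
       spinact [seq segment xy t | xy <- xys] s (flip a.2 K) else 0)).
  apply: polyfun_sum => a; apply: polyfun_mul.
    exists ((1 - 'X) * (xy.1 0 (Vindex a))%:P + 'X * (xy.2 0 (Vindex a))%:P) => t.
    by rewrite !mxE !hornerE.
  case: ((a.2 \in K) == a.1); last exact: polyfun_const.
  by apply: polyfun_mul; [exact: polyfun_const | exact: IH].
exists c => t; rewrite -cE /= rhoE sum_ffunE; apply: eq_bigr => a _.
by rewrite !ffunE.
Qed.

End PolynomialFunctions.

(** * Density of the open set in the Spin-orbit *)

Section Density.

Variables (F : numClosedFieldType) (n : nat) (i0 : 'I_n).
Implicit Types (s p q : ext F n) (ws : seq (V F n)).
Local Notation p0 := (basespinor F i0 false).
Local Notation q0 := (basespinor F i0 true).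

Lemma incident_basespinor : incident p0 q0.
Proof.
have -> : q0 = rho (vec F (true, i0)) p0.
  rewrite rho_vec; apply/ffunP=> K; rewrite !ffunE /= eqb_id.
  have -> : K == [set i0] = (i0 \in K) && (flip i0 K == finset.set0).
    apply/eqP/andP=> [->|[iK /eqP E]].
      by rewrite inE eqxx flip_in ?inE // setDv.
    by rewrite -[K](flipK i0) E flip_notin ?inE // setU0.
  case: (i0 \in K) => //=; case: eqP => [E|_]; last by rewrite mulr0.
  by rewrite -[K](flipK i0) E sgn_flip_id sgn_set0 mulr1.
by apply: incident_rho_self; apply: omega_vac.
Qed.

Lemma spinact_eq0 ws s : unitv ws -> (spinact ws s == 0) = (s == 0).
Proof.
move=> uws; apply/eqP/eqP=> [E|->]; last by rewrite linear0.
by rewrite -(spinact_revK uws s) E linear0.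
Qed.

Lemma spinact_nseq (u : V F n) k s : form u u = 1 -> ~~ odd k ->
  spinact (nseq k u) s = s.
Proof.
move=> uu; rewrite -{2}[k](odd_double_half k) => /negPf->; rewrite add0n.
by elim: k./2 => // m IH; rewrite doubleS !spinact_cons rho_unitK.
Qed.

Lemma incident_spin p q : p \in halfspin F n false -> q \in halfspin F n true ->
    p != 0 -> q != 0 -> incident p q ->
  exists ws, [/\ ~~ odd (size ws), unitv ws,
    p \in <[spinact ws p0]>%VS & q \in <[spinact ws q0]>%VS].
Proof.
move=> pS qS pN0 qN0 pq; have [L LIG Lpq] := incident_IG pN0 qN0 pq.
have [ws [ews uws wsE]] := spin_of_IG i0 LIG; exists ws; split=> //.
  by apply: (annihilated_line ews uws wsE) => // x /Lpq[].
by apply: (annihilated_line ews uws wsE) => // x /Lpq[].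
Qed.

(* The vector with all coordinates 1 satisfies the cube equations. *)
Lemma generic_spin : exists ws, [/\ ~~ odd (size ws), unitv ws
  & forall J, (spinact ws p0 + spinact ws q0) J != 0].
Proof.
pose x : ext F n := [ffun=> 1].
have xY : Y0 x by split=> [J|*]; rewrite !ffunE ?oner_eq0.
have nz b (K : {set 'I_n}) : odd #|K| = b -> parity_part b x K = 1.
  by move=> <-; rewrite !ffunE eqxx.
have nz0 b (K : {set 'I_n}) : odd #|K| = b -> parity_part b x != 0.
  move=> /nz xK; apply/eqP=> /ffunP/(_ K)/eqP.
  by rewrite xK ffunE oner_eq0.
have [||ws [ews uws /vlineP[r pE] /vlineP[t qE]]] :=
    incident_spin (parity_part_halfspin false x) (parity_part_halfspin true x)
      _ _ (Y0_incident xY).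
- by apply: (nz0 _ finset.set0); rewrite cards0.
- by apply: (nz0 _ [set i0]); rewrite cards1.
exists ws; split=> // J; rewrite ffunE.
have /halfspinP pS := spinact_halfspin ews (basespinor_halfspin F i0 false).
have /halfspinP qS := spinact_halfspin ews (basespinor_halfspin F i0 true).
case oJ: (odd #|J|).
  rewrite pS ?oJ // add0r; apply: contra_eq_neq (nz _ _ oJ) => J0.
  by rewrite qE ffunE J0 scaler0 eq_sym oner_eq0.
rewrite qS ?oJ // addr0; apply: contra_eq_neq (nz _ _ oJ) => J0.
by rewrite pE ffunE J0 scaler0 eq_sym oner_eq0.
Qed.

Lemma projS_spin_orbit ws : ~~ odd (size ws) -> unitv ws ->
  projS (<[spinact ws p0]>%VS, <[spinact ws q0]>%VS).
Proof.
move=> ews uws; suff projL b : proj (halfspin F n b) <[spinact ws (basespinor F i0 b)]>%VS.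
  by split; apply: projL.
split; first by rewrite -memvE spinact_halfspin ?basespinor_halfspin.
by rewrite dim_vline spinact_eq0 // basespinor_neq0.
Qed.

(** Interpolate from [ws] to a generic element [ys]. For an equation f of a closed set containing
    [X0], the product of f with all the coordinates vanishes for every parameter: either a
    coordinate is zero or the point lies over [X0]. At 1 the coordinates are nonzero, so f vanishes
    identically, in particular at 0. *)
Lemma spin_orbit_X ws : ~~ odd (size ws) -> unitv ws ->
  X (<[spinact ws p0]>%VS, <[spinact ws q0]>%VS).
Proof.
move=> ews uws Z [E _ ZE] X0Z; apply/ZE.
split=> [|f Ef]; first exact: projS_spin_orbit.
move=> _ _ /vlineP[r ->] /vlineP[t ->].
have [ys [eys uys ysN0]] := generic_spin.
pose u := vec F (true, i0) + vec F (false, i0).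
have uu : form u u = 1 by rewrite !formE !form_vec /= eqxx /=; field.
(* Padding with an even number of copies of a unit vector equalises the lengths without changing
   either action. *)
pose xys := zip (ws ++ nseq (size ys) u) (ys ++ nseq (size ws) u).
pose zs c := [seq segment xy c | xy <- xys].
have szE : size (ws ++ nseq (size ys) u) = size (ys ++ nseq (size ws) u).
  by rewrite !size_cat !size_nseq addnC.
have ezs c : ~~ odd (size (zs c)).
  rewrite size_map size1_zip ?szE // size_cat size_nseq oddD (negPf eys) //.
have zs0 s : spinact (zs 0) s = spinact ws s.
  rewrite -[in RHS](spinact_nseq s uu eys) -spinact_cat; congr (spinact _ s).
  rewrite -[RHS](unzip1_zip (t := ys ++ nseq (size ws) u)) ?szE //.
  by apply: eq_map => xy; rewrite /segment subr0 scale1r scale0r addr0.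
have zs1 s : spinact (zs 1) s = spinact ys s.
  rewrite -[in RHS](spinact_nseq s uu ews) -spinact_cat; congr (spinact _ s).
  rewrite -[RHS](unzip2_zip (s := ws ++ nseq (size ys) u)) ?szE //.
  by apply: eq_map => xy; rewrite /segment subrr scale1r scale0r add0r.
(* [x] tests membership in [Y0], while [y] is the arbitrary point of the two lines at which f is
   evaluated. *)
pose x c : ext F n := spinact (zs c) p0 + spinact (zs c) q0.
pose y c : ext F n := r *: spinact (zs c) p0 + t *: spinact (zs c) q0.
suff fy : forall c, f.@[fun i => y c (enum_val i)] = 0 by rewrite -!zs0; apply: fy.
have pfx K : polyfun (fun c => x c K).
  have [a aE] := polyfun_spinact xys p0 K; have [b bE] := polyfun_spinact xys q0 K.
  by exists (a + b) => c; rewrite hornerD -aE -bE ffunE.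
have pfy K : polyfun (fun c => y c K).
  have [a aE] := polyfun_spinact xys p0 K; have [b bE] := polyfun_spinact xys q0 K.
  exists (r *: a + t *: b) => c; rewrite hornerD !hornerZ -aE -bE.
  by rewrite !ffunE.
apply: (@polyfun_mul_eq0 _ (fun c => f.@[fun i => y c (enum_val i)])
  (fun c => \prod_K x c K) 1).
- by apply: polyfun_meval => i; apply: pfy.
- exact: polyfun_prod.
- move=> c; have [xN0|] := boolP [forall K, x c K != 0]; last first.
    rewrite negb_forall => /existsP[K]; rewrite negbK => /eqP xK.
    by rewrite (bigD1 K) //= xK mul0r mulr0.
  have pS := spinact_halfspin (ezs c) (basespinor_halfspin F i0 false).
  have qS := spinact_halfspin (ezs c) (basespinor_halfspin F i0 true).
  have xY : Y0 (x c).
    apply: incident_Y0 => //; last exact/forallP.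
    exact/incident_spinact/incident_basespinor.
  have /X0Z/ZE[_ /(_ f Ef) fX] : X0 (<[spinact (zs c) p0]>%VS, <[spinact (zs c) q0]>%VS).
    by exists (x c) => //; rewrite !parity_part_add.
  by rewrite (fX (r *: spinact (zs c) p0) (t *: spinact (zs c) q0)) ?mul0r //=
    memvZ ?memv_line.
- by apply/prodf_neq0 => K _; rewrite /x !zs1.
Qed.

End Density.

(** * Identification of the closure with the isotropic Grassmannian *)

Theorem theorem5p3 (R : realType) (n : nat) (hn : (3 <= n)%N)
    (phi : 'Hom(ext R[i] (n + n), ext2 R[i] n))
    (hphi : equivariant_inclusion phi) :
  (forall L, IG L -> exists2 PQ, projS PQ & segre PQ = IG_embedding phi L) /\
  (forall PQ, X PQ <->
     projS PQ /\ exists2 L, IG L & segre PQ = IG_embedding phi L).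
Proof.
have n0 : (0 < n)%N by apply: leq_trans hn.
pose i0 := Ordinal n0; split=> [L LIG|[P Q]].
  have [ws [ews uws _ ->]] := IG_embedding_line i0 hphi LIG.
  exists (<[spinact ws (basespinor _ i0 false)]>%VS, <[spinact ws (basespinor _ i0 true)]>%VS).
    exact: projS_spin_orbit.
  exact: tensv_line.
split=> [XPQ|[[/= [PS dP] [/= QS dQ]] [L LIG]]].
  (* The incidence variety is one of the closed sets containing [X0], hence contains the closure. *)
  have [PQS PQi] := XPQ _ (@zclosed_incidence _ n) (fun PQ => X0_incidence n0).
  split=> //; have [[/= PS dP] [/= QS dQ]] := PQS.
  have [p p0 PE] := dim1P dP; have [q q0 QE] := dim1P dQ.
  have pP : p \in P by rewrite PE memv_line.
  have qQ : q \in Q by rewrite QE memv_line.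
  have [L LIG Lpq] := incident_IG p0 q0 (PQi p q pP qQ).
  exists L => //; have [ws [ews uws wsE ->]] := IG_embedding_line i0 hphi LIG.
  have pl : p \in <[spinact ws (basespinor _ i0 false)]>%VS.
    by apply: (annihilated_line ews uws wsE) => [|x /Lpq[]//]; apply: subvP pP.
  have ql : q \in <[spinact ws (basespinor _ i0 true)]>%VS.
    by apply: (annihilated_line ews uws wsE) => [|x /Lpq[]//]; apply: subvP qQ.
  by rewrite /segre /= PE QE (vline_mem p0 pl) (vline_mem q0 ql) tensv_line.
have [ws [ews uws _ ->]] := IG_embedding_line i0 hphi LIG.
have [p p0 PE] := dim1P dP; have [q q0 QE] := dim1P dQ.
rewrite /segre /= PE QE tensv_line => E.
have /vlineP[r rE] : tens p q \in
    <[tens (spinact ws (basespinor _ i0 false)) (spinact ws (basespinor _ i0 true))]>%VS.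
  by rewrite -E memv_line.
(* A nonzero rank-one tensor determines the lines of its factors, so (P, Q) is the orbit point
   itself. *)
have [pl ql] := tens_eq_line p0 q0 rE.
rewrite (vline_mem p0 pl) (vline_mem q0 ql); exact: spin_orbit_X.
Qed.
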